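(* Let $k\ge4$ be even. If $\mathcal{O}(\mathbb{C},k)\neq\emptyset$, then $6\mid k$. Moreover, $\mathcal{O}(\mathbb{C},k)$ is exactly the union of the $\mathcal{G}_0$-orbits of the quadruples $(i,j\mid s,t)$ listed below (each family being present only when its divisibility condition holds); each listed quadruple lies in $\mathcal{O}(\mathbb{C},k)$ and satisfies $\phi^{\omega}\frac{\phi^j-1}{\phi^i-1}=\frac{\phi^t-1}{\phi^s-1}$ with the stated $\omega$ (in all cases $\omega=\frac{(t+i)-(s+j)}{2}$). (1) If $k=6\ell$: $(u,\ell\mid 2u,3\ell-u)$ for every integer $u$ with $1\le u\le\lfloor k/4\rfloor$ and $u\ne\ell$; $\omega=\ell-u$. (2) If $k=30m$: $(m,3m\mid3m,11m)$, $\omega=3m$; $(3m,5m\mid5m,9m)$, $\omega=m$; $(7m,9m\mid9m,13m)$, $\omega=m$; $(m,2m\mid4m,9m)$, $\omega=2m$; $(2m,3m\mid5m,8m)$, $\omega=m$; $(8m,9m\mid11m,14m)$, $\omega=m$; $(2m,3m\mid7m,14m)$, $\omega=3m$; $(3m,4m\mid8m,13m)$, $\omega=2m$; $(4m,5m\mid9m,14m)$, $\omega=2m$. (3) If $k=42m$: $(2m,3m\mid9m,16m)$, $\omega=3m$; $(3m,4m\mid10m,15m)$, $\omega=2m$; $(8m,9m\mid15m,20m)$, $\omega=2m$. (4) If $k=60m$: $(3m,4m\mid16m,27m)$, $\omega=5m$; $(5m,6m\mid18m,25m)$, $\omega=3m$; $(8m,9m\mid21m,28m)$, $\omega=3m$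.
   Context: $\phi=\exp(2\pi\mathrm{i}/k)$, $\mathbf{k}=\{1,\dots,k-1\}$, $\mathbf{k}_0=\{0,\dots,k-1\}$. A quadruple $(i,j\mid s,t)\in\mathbf{k}^4$ with $i\ne s$ is an overlap if $\phi^\omega(\phi^j-1)(\phi^s-1)=(\phi^i-1)(\phi^t-1)$ for some $\omega\in\mathbf{k}_0$; it is trivial if one of $i\equiv\pm j$, $j\equiv\pm t$, $t\equiv\pm s$, $s\equiv\pm i\pmod k$ holds, nontrivial otherwise. $\mathcal{O}(\mathbb{C},k)$ is the set of nontrivial overlaps. $\mathcal{G}_0$ is the group of maps on $\mathbf{k}^4$ generated by $\kappa_1,\dots,\kappa_4$ (where $\kappa_m$ replaces the $m$-th entry $u$ of $(i,j\mid s,t)$ by $k-u$) and the coordinate permutations $(i,t)$, $(j,s)$, $(i,j)(s,t)$. *)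

(* Defs.v *)
From HB Require Import structures.
From mathcomp Require Import all_boot all_order all_algebra.
From mathcomp Require Import reals trigo.
From mathcomp Require Import complex.
Set Implicit Arguments. Unset Strict Implicit. Unset Printing Implicit Defensive.
Import Order.TTheory GRing.Theory Num.Theory.
Local Open Scope ring_scope.

Definition phi (R : realType) (k : nat) : R[i] :=
  Complex (cos (2 * pi / k%:R)) (sin (2 * pi / k%:R)).

Record quad := Quad { qi : nat; qj : nat; qs : nat; qt : nat }.

Definition in_k (k u : nat) : bool := (1 <= u <= k.-1)%N.
Definition in_k4 (k : nat) (q : quad) : bool :=
  [&& in_k k (qi q), in_k k (qj q), in_k k (qs q) & in_k k (qt q)].

Definition is_overlap (R : realType) (k : nat) (q : quad) : Prop :=
  in_k4 k q /\ qi q <> qs q /\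
  exists w : nat, (w < k)%N /\
    phi R k ^+ w * (phi R k ^+ qj q - 1) * (phi R k ^+ qs q - 1)
    = (phi R k ^+ qi q - 1) * (phi R k ^+ qt q - 1).

Definition pm_cong (k u v : nat) : bool :=
  (u == v %[mod k]) || (u + v == 0 %[mod k]).

Definition trivial_quad (k : nat) (q : quad) : bool :=
  [|| pm_cong k (qi q) (qj q), pm_cong k (qj q) (qt q),
      pm_cong k (qt q) (qs q) | pm_cong k (qs q) (qi q)].

Definition nontriv_overlap (R : realType) (k : nat) (q : quad) : Prop :=
  is_overlap R k q /\ ~~ trivial_quad k q.

Definition kappa1 (k : nat) (q : quad) := Quad (k - qi q) (qj q) (qs q) (qt q).
Definition kappa2 (k : nat) (q : quad) := Quad (qi q) (k - qj q) (qs q) (qt q).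
Definition kappa3 (k : nat) (q : quad) := Quad (qi q) (qj q) (k - qs q) (qt q).
Definition kappa4 (k : nat) (q : quad) := Quad (qi q) (qj q) (qs q) (k - qt q).
Definition swap_it (q : quad) := Quad (qt q) (qj q) (qs q) (qi q).
Definition swap_js (q : quad) := Quad (qi q) (qs q) (qj q) (qt q).
Definition swap_ij_st (q : quad) := Quad (qj q) (qi q) (qt q) (qs q).

Definition G0_gen (k : nat) (g : quad -> quad) : Prop :=
  g = kappa1 k \/ g = kappa2 k \/ g = kappa3 k \/ g = kappa4 k \/
  g = swap_it \/ g = swap_js \/ g = swap_ij_st.

(* G_0-orbit of q0: closure of {q0} under the generators (all generators are
   involutions and G_0 is finite, so this is exactly the orbit) *)
Inductive G0_orbit (k : nat) (q0 : quad) : quad -> Prop :=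
  | G0_orbit_base : G0_orbit k q0 q0
  | G0_orbit_step g q : G0_gen k g -> G0_orbit k q0 q -> G0_orbit k q0 (g q).

Definition listed (k : nat) (q : quad) (w : int) : Prop :=
  (exists l u : nat, k = (6 * l)%N /\ (1 <= u <= k %/ 4)%N /\ u <> l /\
     q = Quad u l (2 * u) (3 * l - u) /\ w = (l%:Z - u%:Z)%R)
  \/ (exists m : nat, k = (30 * m)%N /\
     ( q = Quad m (3 * m) (3 * m) (11 * m) /\ w = (3 * m)%N%:Z \/
         q = Quad (3 * m) (5 * m) (5 * m) (9 * m) /\ w = m%:Z \/
         q = Quad (7 * m) (9 * m) (9 * m) (13 * m) /\ w = m%:Z \/
         q = Quad m (2 * m) (4 * m) (9 * m) /\ w = (2 * m)%N%:Z \/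
         q = Quad (2 * m) (3 * m) (5 * m) (8 * m) /\ w = m%:Z \/
         q = Quad (8 * m) (9 * m) (11 * m) (14 * m) /\ w = m%:Z \/
         q = Quad (2 * m) (3 * m) (7 * m) (14 * m) /\ w = (3 * m)%N%:Z \/
         q = Quad (3 * m) (4 * m) (8 * m) (13 * m) /\ w = (2 * m)%N%:Z \/
         q = Quad (4 * m) (5 * m) (9 * m) (14 * m) /\ w = (2 * m)%N%:Z))
  \/ (exists m : nat, k = (42 * m)%N /\
     ( q = Quad (2 * m) (3 * m) (9 * m) (16 * m) /\ w = (3 * m)%N%:Z \/
         q = Quad (3 * m) (4 * m) (10 * m) (15 * m) /\ w = (2 * m)%N%:Z \/
         q = Quad (8 * m) (9 * m) (15 * m) (20 * m) /\ w = (2 * m)%N%:Z))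
  \/ (exists m : nat, k = (60 * m)%N /\
     ( q = Quad (3 * m) (4 * m) (16 * m) (27 * m) /\ w = (5 * m)%N%:Z \/
         q = Quad (5 * m) (6 * m) (18 * m) (25 * m) /\ w = (3 * m)%N%:Z \/
         q = Quad (8 * m) (9 * m) (21 * m) (28 * m) /\ w = (3 * m)%N%:Z)).

(* Main.v *)
From Stdlib Require Import ZArith.
Require Import Defs.
From HB Require Import structures.
From mathcomp Require Import all_boot all_order all_algebra all_field.
From mathcomp Require Import reals trigo.
From mathcomp Require Import complex.
From mathcomp Require Import zify ssrZ ring lra.
Set Implicit Arguments. Unset Strict Implicit. Unset Printing Implicit Defensive.
Import Order.TTheory GRing.Theory Num.Theory.
Local Open Scope ring_scope.

(** With rho = exp(i pi / k), the overlap relation becomes the parity condition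
    i + j + s + t even together with
      sin(j pi/k) sin(s pi/k) = sin(i pi/k) sin(t pi/k),
    that is, a vanishing sum of four cosines, or of eight roots of unity closed
    under inversion.  Galois conjugation splits such a sum into vanishing sums over
    the cosets of the 210-th roots of unity (Mann).  Hence either the cosines
    cancel in pairs, which only trivial overlaps do; or one cosine is 0 and the
    other three are those of angles pi/3 apart up to sign, which gives the infinite
    family; or all eight roots have order dividing 420.  The last case is a finite
    problem at level 420: the relation persists modulo a prime p = 1 mod 420, where
    all collisions between products of two sines can be listed. *)

(** Why 420 rather than 210: if a coset of the 210-th roots of unity contains both [w] and [w^-1],
    then [w^420 = 1]. Away from the 420-th roots of unity a coset therefore takes at most one root
    from each of the four pairs [w], [w^-1], and conjugation supplies a second vanishing sum, that
    of the inverses. Two such sums in at most four unknowns are solved by symmetric functions.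
    Reduction modulo p works in one direction only: Z[z] maps to Z/p, so a relation over C persists,
    while a relation modulo p may be accidental. A well-chosen p leaves no accident. That the listed
    quadruples are overlaps is a separate matter, settled by the double-angle formula for the
    infinite family and by explicit multiples of cyclotomic polynomials for the sporadic ones.
    Levels 420 and k are compared through angles: entries [u] and [u'] with [420 u = k u'] have the
    same sine. *)

(** * Cyclotomic polynomials in an arbitrary numeric field *)

Lemma prod_horner_Cyclotomic (R : comNzRingType) m (x : R) : (0 < m)%N ->
  \prod_(d <- divisors m) (map_poly intr 'Phi_d).[x] = x ^+ m - 1.
Proof.
move=> m_gt0; rewrite -horner_prod -rmorph_prod prod_Cyclotomic //.
by rewrite rmorphB rmorph1 /= map_polyXn !hornerE.
Qed.

(** Some factor ['Phi_d] of [X^n - 1] vanishes at [z]; then [z ^+ d = 1] with [d] dividing [n], and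
    primitivity forces [d = n]. *)
Lemma horner_map_Cyclotomic (F : numFieldType) n (z : F) :
  n.-primitive_root z -> (map_poly intr 'Phi_n).[z] = 0.
Proof.
move=> prz; have n_gt0 := prim_order_gt0 prz.
have prodE m := @prod_horner_Cyclotomic F m z.
have /eqP := prodE n n_gt0; rewrite prim_expr_order // subrr.
rewrite prodf_seq_eq0 => /hasP[d /= d_n /eqP dz].
have d_dvd : (d %| n)%N by rewrite dvdn_divisors.
have d_gt0 : (0 < d)%N := dvdn_gt0 n_gt0 d_dvd.
have zd : z ^+ d = 1.
  apply/eqP; rewrite -subr_eq0 -prodE // (big_rem d) /= ?dz ?mul0r //.
  by rewrite -dvdn_divisors.
have n_dvd : (n %| d)%N by rewrite (prim_order_dvd prz) zd.
suff -> : n = d by [].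
by apply/eqP; rewrite eqn_dvd n_dvd d_dvd.
Qed.

(** Irreducibility of ['Phi_n] over the rationals comes from the minimal polynomial of a primitive
    root [z'] in [algC]. It is used in [F] through the gcd with [P] over the rationals: this gcd
    vanishes at [z], so it is not constant and must be a multiple of ['Phi_n]. As ['Phi_n] is monic,
    the division itself takes place over the integers. *)
Lemma dvd_Cyclotomic (F : numFieldType) n (z : F) (P : {poly int}) :
  n.-primitive_root z -> (map_poly intr P).[z] = 0 ->
  exists r, P = r * 'Phi_n.
Proof.
move=> prz Pz; have n_gt0 := prim_order_gt0 prz.
have [z' prz'] := C_prim_root_exists n_gt0.
have [p [minE p_monic] rootE] := minCpolyP z'.
have pE : p = map_poly intr 'Phi_n.
  apply: (map_inj_poly (@fmorph_inj _ _ (ratr : rat -> algC)) (rmorph0 _)).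
  rewrite -minE (minCpoly_cyclotomic prz') -(Cintr_Cyclotomic prz') -map_poly_comp.
  by apply: eq_map_poly => a /=; rewrite ratr_int.
have mapQ (q : {poly int}) :
    map_poly (ratr : rat -> F) (map_poly intr q) = map_poly intr q.
  by rewrite -map_poly_comp; apply: eq_map_poly => a /=; rewrite ratr_int.
have p_dvd : p %| map_poly intr P.
  set Pq := map_poly intr P.
  have dz : root (map_poly (ratr : rat -> F) (gcdp p Pq)) z.
    rewrite gcdp_map root_gcd pE !mapQ /root horner_map_Cyclotomic //.
    by rewrite Pz eqxx.
  have d0 : gcdp p Pq != 0 by rewrite gcdp_eq0 negb_and monic_neq0.
  have [e pdE] : exists e, p = e * gcdp p Pq.
    exists (p %/ gcdp p Pq); by rewrite divpK ?dvdp_gcdl.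
  have e0 : e != 0.
    by apply: contraTneq (monic_neq0 p_monic) => e0; rewrite pdE e0 mul0r eqxx.
  have : root (map_poly (ratr : rat -> algC) p) z' by rewrite rootE.
  rewrite {1}pdE rmorphM rootM !rootE => /orP[pe|pd]; last first.
    exact: dvdp_trans pd (dvdp_gcdr _ _).
  have := dvdp_leq e0 pe; rewrite {1}pdE size_mul // => le_e.
  have d1 : (size (gcdp p Pq) <= 1)%N.
    have : (size e != 0)%N by rewrite size_poly_eq0.
    by move: le_e; case: (size e) => // m; rewrite addSn /= -addn1 leq_add2l.
  move: dz; rewrite (size1_polyC d1) map_polyC /root hornerC fmorph_eq0.
  by rewrite -polyC_eq0 -size1_polyC // (negPf d0).
pose r := Pdiv.Ring.rmodp P 'Phi_n.
have PE : P = Pdiv.Ring.rdivp P 'Phi_n * 'Phi_n + r.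
  exact: Pdiv.RingMonic.rdivp_eq (Cyclotomic_monic n) P.
exists (Pdiv.Ring.rdivp P 'Phi_n).
suff r0 : r = 0 by rewrite {1}PE r0 addr0.
have p_r : p %| map_poly intr r.
  have: p %| map_poly intr P by [].
  by rewrite PE rmorphD rmorphM /= dvdp_addr // pE dvdp_mull.
apply/eqP/contraT => r0.
have r0' : map_poly (intr : int -> rat) r != 0.
  by rewrite map_poly_eq0_id0 // intr_eq0 lead_coef_eq0.
have := dvdp_leq r0' p_r; rewrite pE !size_map_inj_poly ?rmorph0 //; try exact: intr_inj.
by rewrite leqNgt Pdiv.Ring.ltn_rmodp monic_neq0 // Cyclotomic_monic.
Qed.

Lemma sum_prim_root_conj (F : numFieldType) N (z z' : F) (s : seq nat) :
    N.-primitive_root z -> N.-primitive_root z' ->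
  \sum_(e <- s) z ^+ e = 0 -> \sum_(e <- s) z' ^+ e = 0.
Proof.
have sumE x : \sum_(e <- s) x ^+ e =
    (map_poly (intr : int -> F) (\sum_(e <- s) 'X^e)).[x].
  rewrite rmorph_sum horner_sum; apply: eq_bigr => e _.
  by rewrite /= map_polyXn hornerXn.
move=> prz prz'; rewrite !sumE => /(dvd_Cyclotomic prz)[r ->].
by rewrite rmorphM hornerM (horner_map_Cyclotomic prz') mulr0.
Qed.

Lemma sum_root1_powers (F : fieldType) p (x : F) :
  x ^+ p = 1 -> \sum_(t < p) x ^+ t = if x == 1 then p%:R else 0.
Proof.
move=> xp; case: eqP => [->|/eqP x1].
  rewrite (eq_bigr (fun=> 1)) => [|i _]; last by rewrite expr1n.
  by rewrite sumr_const card_ord.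
apply: (mulfI (_ : x - 1 != 0)); first by rewrite subr_eq0.
by rewrite -subrX1 xp subrr mulr0.
Qed.

(* Discrete Fourier inversion over Z/p, for a transform supported at t0. *)
Lemma sum_class_prim_root (F : numFieldType) p M (z : F) (s : seq nat) t0 e0 :
    prime p -> (p * M)%N.-primitive_root z -> (t0 < p)%N ->
    (forall t, (t < p)%N -> t != t0 ->
       \sum_(e <- s) z ^+ (e * (1 + t * M)) = 0) ->
  p%:R * \sum_(e <- s | e == e0 %[mod p]) z ^+ e =
    (z ^+ M) ^- (e0 * t0) * \sum_(e <- s) z ^+ (e * (1 + t0 * M)).
Proof.
move=> pr_p prz lt_t0 f0; set w := z ^+ M.
have N_gt0 := prim_order_gt0 prz.
have M_gt0 : (0 < M)%N by move: N_gt0; rewrite muln_gt0 => /andP[].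
have prw : p.-primitive_root w.
  by have := exp_prim_root prz M; rewrite gcdnMl mulnK.
have w0 e : w ^+ e != 0 by rewrite expf_neq0 // (prim_root_eq0 prw) -lt0n prime_gt0.
transitivity (\sum_(t < p) w ^- (e0 * t) *
                \sum_(e <- s) z ^+ (e * (1 + t * M))); last first.
  rewrite (bigD1 (Ordinal lt_t0)) //= [X in _ + X]big1 ?addr0 // => t ht.
  by rewrite f0 ?mulr0.
under [RHS]eq_bigr do rewrite mulr_sumr.
rewrite [RHS]exchange_big /= mulr_sumr big_mkcond /=; apply: eq_bigr => e _.
have expE t : w ^- (e0 * t) * z ^+ (e * (1 + t * M)) =
    z ^+ e * (w ^+ e / w ^+ e0) ^+ t.
  rewrite mulnDr muln1 exprD mulrCA; congr (_ * _).
  rewrite exprMn exprVn. rewrite -!exprM mulrC; congr (_ / _).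
  by congr (z ^+ _); ring.
under [RHS]eq_bigr do rewrite expE.
rewrite -mulr_sumr sum_root1_powers; last first.
  by rewrite exprMn exprVn -!exprM !(mulnC _ p) !exprM (prim_expr_order prw)
             !expr1n invr1 mulr1.
rewrite -(inj_eq (mulIf (w0 e0))) mulfVK // mul1r (eq_prim_root_expr prw).
by case: ifP => _; rewrite ?mulr0 // mulrC.
Qed.

(** The exponents [1 + t * M] are prime to [M], so [z ^+ (1 + t * M)] is a conjugate of [z] unless
    [p] divides [1 + t * M]. If [p] divides [M] this never happens and all conjugate sums vanish.
    Otherwise it happens for a single [t0]; having fewer than [p] terms, [s] misses some residue
    class [r], whose empty sum forces the transform to vanish at [t0] as well. *)
Lemma vanishing_sum_mod_prime (F : numFieldType) p M (z : F) (s : seq nat) e0 :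
    prime p -> (p %| M)%N || (size s < p)%N ->
    (p * M)%N.-primitive_root z -> \sum_(e <- s) z ^+ e = 0 ->
  \sum_(e <- s | e == e0 %[mod p]) z ^+ e = 0.
Proof.
move=> pr_p hp prz s0.
have p_gt0 := prime_gt0 pr_p.
have fE t : coprime (1 + t * M) p ->
    \sum_(e <- s) z ^+ (e * (1 + t * M)) = 0.
  move=> co_p; have prz' : (p * M)%N.-primitive_root (z ^+ (1 + t * M)).
    by rewrite prim_root_exp_coprime // coprimeMr co_p /coprime gcdnC addnC gcdnMDl gcdn1.
  under eq_bigr do rewrite mulnC exprM.
  exact: sum_prim_root_conj prz prz' s0.
have p_neq0 : p%:R != 0 :> F by rewrite pnatr_eq0 -lt0n.
apply: (mulfI p_neq0); rewrite mulr0.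
have [[t0 lt0] /= bad|good] := pickP (fun t : 'I_p => ~~ coprime (1 + t * M) p); last first.
  rewrite (sum_class_prim_root e0 pr_p prz p_gt0) => [|t lt_t _].
    by rewrite fE ?mulr0 //; have /negbFE := good (Ordinal p_gt0).
  by apply: fE; have /negbFE := good (Ordinal lt_t).
have p_bad : (p %| 1 + t0 * M)%N.
  by move: bad; rewrite /= coprime_sym prime_coprime // negbK.
have pM : ~~ (p %| M)%N.
  apply/negP => pM; move: p_bad; rewrite dvdn_addl ?dvdn_mull // dvdn1.
  by move/eqP => p1; rewrite p1 in pr_p.
have f0 t : (t < p)%N -> t != t0 :> nat ->
    \sum_(e <- s) z ^+ (e * (1 + t * M)) = 0.
  move=> lt_t ne_t; apply: fE; rewrite coprime_sym prime_coprime //.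
  apply: contra ne_t => p_t.
  have : 1 + t * M == 1 + t0 * M %[mod p].
    by rewrite (eqP p_t) (eqP p_bad).
  rewrite eqn_modDl; have co_M : coprime p M by rewrite prime_coprime.
  have [le_t|/ltnW le_t] := leqP t0 t.
    by rewrite eqn_mod_dvd ?leq_mul // -mulnBl Gauss_dvdl // -eqn_mod_dvd // !modn_small.
  by rewrite eq_sym eqn_mod_dvd ?leq_mul // -mulnBl Gauss_dvdl // -eqn_mod_dvd //
             !modn_small // eq_sym.
move: hp; rewrite (negPf pM) /= => lt_s.
have [r r_s] : exists r : 'I_p, (r : nat) \notin [seq (e %% p)%N | e <- s].
  apply/existsP; apply: contraTT lt_s => /existsPn all_s.
  rewrite -leqNgt -(size_iota 0 p) -(size_map (modn^~ p) s).
  apply: uniq_leq_size (iota_uniq 0 p) _ => r; rewrite mem_iota /= => lt_r.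
  by have := all_s (Ordinal lt_r); rewrite negbK.
have := sum_class_prim_root r pr_p prz lt0 f0.
rewrite big_seq_cond big_pred0 => [|e]; last first.
  apply/negP => /andP[e_s /eqP er]; case/negP: r_s.
  by apply/mapP; exists e => //; rewrite er modn_small.
move=> /esym/eqP; rewrite mulr0 mulf_eq0 => /orP[|/eqP ft0].
  rewrite invr_eq0 !expf_eq0 (prim_root_eq0 prz).
  by rewrite eqn0Ngt (prim_order_gt0 prz) !andbF.
by rewrite (sum_class_prim_root e0 pr_p prz lt0 f0) ft0 mulr0.
Qed.

(* The argument of H. B. Mann: 210 = 2 * 3 * 5 * 7 is the product of the primes up
   to the number of terms; any other prime power factor of N can be split off. *)
Lemma vanishing_sum_split (F : numFieldType) N (z : F) (s : seq nat) e0 :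
    N.-primitive_root z -> (size s <= 10)%N -> \sum_(e <- s) z ^+ e = 0 ->
  \sum_(e <- s | 210 * e == 210 * e0 %[mod N]) z ^+ e = 0.
Proof.
have [n le_N] := ubnP N.
elim: n => // n IHn in N le_N z s e0 * => prz le_s s0.
have N_gt0 := prim_order_gt0 prz.
have [N_dvd|N_ndvd] := boolP (N %| 210)%N.
  rewrite (eq_bigl predT) // => e.
  by rewrite !(eqP (dvdn_mulr _ N_dvd)) eqxx.
(* A prime power of [N] not dividing 210 belongs to a prime above 10, hence above the number of
   terms, or to one of 2, 3, 5, 7 with exponent at least 2. *)
have [p [pr_p pN hp]] : exists p, [/\ prime p, (p %| N)%N &
    (p * p %| N)%N || (10 < p)%N].
  have [all_p|/allPn[p]] := boolP (all (fun p : nat => N`_p %| 210)%N (primes N)).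
    by case/negP: N_ndvd; apply/(dvdn_partP _ N_gt0) => p p_N; exact: (allP all_p).
  rewrite mem_primes => /and3P[pr_p _ pN]; rewrite p_part pfactor_dvdn // -ltnNge => lt_l.
  exists p; split=> //; case: (leqP p 10) => [le_p|_]; last by rewrite orbT.
  rewrite orbF -[(p * p)%N]/(p ^ 2)%N pfactor_dvdn //.
  apply: leq_trans lt_l; rewrite ltnS logn_gt0 mem_primes pr_p /=.
  have /allP/(_ p) : all (fun q => prime q ==> (q %| 210))%N (iota 0 11) by [].
  by rewrite mem_iota ltnS le_p pr_p => /(_ isT).
have p_gt1 := prime_gt1 pr_p.
pose M := (N %/ p)%N; have NE : N = (p * M)%N by rewrite /M mulnC divnK.
have M_gt0 : (0 < M)%N by move: N_gt0; rewrite NE muln_gt0 => /andP[].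
(* [d e] represents [e - e0] modulo [N] without truncated subtraction. *)
pose d e := (e + N.-1 * e0)%N.
have dE a e m : (m %| N)%N -> (a * e == a * e0 %[mod m])%N = (m %| a * d e)%N.
  move=> mN; rewrite -(eqn_modDr (a * (N.-1 * e0))) -!mulnDr -mulSn prednK //.
  by rewrite /dvdn (eqP (_ : m %| a * (N * e0))%N) // dvdn_mull // dvdn_mulr.
have dE1 e : (e == e0 %[mod p])%N = (p %| d e)%N by rewrite -[d e]mul1n -dE // !mul1n.
have dp e : (N %| 210 * d e)%N -> (p %| d e)%N.
  move=> N_d; case/orP: hp => [ppN|lt_p].
    apply: contraT => np_d; have: (p * p %| 210)%N.
      rewrite -(Gauss_dvdl 210 (_ : coprime (p * p) (d e))) ?(dvdn_trans ppN) //.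
      by rewrite coprimeMl andbb prime_coprime.
    move=> pp; have lt_p : (p < 15)%N.
      rewrite ltnNge; apply/negP => le_p.
      by have := leq_trans (leq_mul le_p le_p) (@dvdn_leq _ 210 isT pp).
    have /allP/(_ p) : all (fun q => (1 < q) ==> ~~ (q * q %| 210))%N (iota 0 15) by [].
    by rewrite mem_iota lt_p p_gt1 pp => /(_ isT).
  have: (p %| 210 * d e)%N := dvdn_trans pN N_d.
  rewrite Euclid_dvdM // => /orP[p210|//]; move: lt_p pr_p p210 => {}hp pr_p p210.
  have: p \in primes 210 by rewrite mem_primes pr_p.
  by rewrite !inE => /or4P[]/eqP pE; rewrite pE in hp.
have prM : M.-primitive_root (z ^+ p).
  by have := exp_prim_root prz p; rewrite NE gcdnMr mulKn // prime_gt0.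
(* On the class of [e0] modulo [p], [z ^+ e] is a fixed factor times a power of [z ^+ p], so the sum
   over this class is again a vanishing sum, at level [M = N / p]. *)
pose s' := [seq (d e %/ p)%N | e <- s & (e == e0 %[mod p])%N].
have powE e : (e == e0 %[mod p])%N -> (z ^+ p) ^+ (d e %/ p) = z ^+ (N.-1 * e0) * z ^+ e.
  by rewrite dE1 => p_d; rewrite -exprM mulnC divnK // -exprD addnC.
have s'0 : \sum_(f <- s') (z ^+ p) ^+ f = 0.
  rewrite big_map big_filter (eq_bigr _ powE) -mulr_sumr.
  rewrite (@vanishing_sum_mod_prime _ _ M _ _ e0 pr_p _ _ s0) ?mulr0 -?NE //.
  case/orP: hp => [ppN|lt_p]; last by rewrite (leq_ltn_trans le_s) ?orbT.
  by move: ppN; rewrite {1}NE dvdn_pmul2l ?prime_gt0 // => ->.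
have lt_M : (M < n)%N by rewrite (leq_trans _ (ltnSE le_N)) // NE -[X in (X < _)%N]mul1n ltn_pmul2r.
have le_s' : (size s' <= 10)%N.
  by rewrite size_map size_filter (leq_trans (count_size _ _)).
have := IHn M lt_M _ _ 0%N prM le_s' s'0.
rewrite big_map big_filter_cond.
rewrite (eq_bigr (fun e => z ^+ (N.-1 * e0) * z ^+ e)) => [|e /andP[+ _]]; last exact: powE.
rewrite -mulr_sumr => /eqP; rewrite mulf_eq0 expf_eq0 (prim_root_eq0 prz) eqn0Ngt N_gt0.
rewrite andbF /= => /eqP; rewrite muln0 mod0n => class0.
rewrite -[RHS]class0; apply: eq_bigl => e.
rewrite dE // dE1 -/(dvdn M _); apply/idP/andP => [N_d|[p_d M_d]].
  split; first exact: dp.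
  by rewrite -(@dvdn_pmul2l p) ?prime_gt0 // -NE mulnCA [(p * _)%N]mulnC divnK // dp.
by rewrite -(divnK p_d) mulnA NE mulnC dvdn_pmul2r ?prime_gt0.
Qed.

(** * Vanishing sums of four cosines *)

(** Each vanishing sum makes the second symmetric function of the other triple vanish, as
    [A * B + B * C + C * A] is [A * B * C] times the sum of the inverses. For roots of unity,
    [A + A'] is twice a cosine, and the identity says that the squares of the three cosines add up
    to 3/2. *)
Lemma three_unit_sum (F : fieldType) (A B C A' B' C' : F) :
    A * A' = 1 -> B * B' = 1 -> C * C' = 1 ->
    A + B + C = 0 -> A' + B' + C' = 0 ->
  (A + A') ^+ 2 + (B + B') ^+ 2 + (C + C') ^+ 2 = 6%:R.
Proof.
move=> hA hB hC s0 s0'.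
have e2 : A * B + B * C + C * A = 0.
  transitivity (A * B * (C * C') + B * C * (A * A') + C * A * (B * B')).
    by rewrite hA hB hC; ring.
  by transitivity (A * B * C * (A' + B' + C')); [ring | rewrite s0' mulr0].
have e2' : A' * B' + B' * C' + C' * A' = 0.
  transitivity (A' * B' * (C * C') + B' * C' * (A * A') + C' * A' * (B * B')).
    by rewrite hA hB hC; ring.
  by transitivity (A' * B' * C' * (A + B + C)); [ring | rewrite s0 mulr0].
transitivity ((A + B + C) ^+ 2 - 2 * (A * B + B * C + C * A) +
  (A' + B' + C') ^+ 2 - 2 * (A' * B' + B' * C' + C' * A') +
  2 * (A * A' + B * B' + C * C')); first by ring.
by rewrite s0 s0' e2 e2' hA hB hC; ring.
Qed.

(** Four unit vectors with sum 0 form a rhombus: with the first and third symmetric functions equal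
    to 0, [(A + B) * (A + C) * (A + D)] vanishes, so [A] is opposite to one of the others, and so is
    its inverse. *)
Lemma four_unit_sum (F : fieldType) (A B C D A' B' C' D' : F) :
    A * A' = 1 -> B * B' = 1 -> C * C' = 1 -> D * D' = 1 ->
    A + B + C + D = 0 -> A' + B' + C' + D' = 0 ->
  [\/ A + A' + (B + B') = 0, A + A' + (C + C') = 0 | A + A' + (D + D') = 0].
Proof.
move=> hA hB hC hD s0 s0'.
have e3 : (A + B) * (A + C) * (A + D) = 0.
  transitivity (A ^+ 2 * (A + B + C + D) + A * B * C * D * (A' + B' + C' + D')).
    transitivity (A ^+ 2 * (A + B + C + D) + (A * A') * B * C * D
      + A * (B * B') * C * D + A * B * (C * C') * D + A * B * C * (D * D')).
      by rewrite hA hB hC hD; ring.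
    by ring.
  by rewrite s0 s0' !mulr0 addr0.
have opp X X' : X * X' = 1 -> A + X = 0 -> A + A' + (X + X') = 0.
  move=> hX AX; have A'X' : A' + X' = 0.
    transitivity (A' * (X * X') + X' * (A * A')); first by rewrite hX hA; ring.
    by transitivity (A' * X' * (A + X)); [ring | rewrite AX mulr0].
  by rewrite addrACA AX A'X' addr0.
move/eqP: e3; rewrite !mulf_eq0 => /orP[/orP[]|] /eqP/opp.
- by move/(_ _ hB); constructor 1.
- by move/(_ _ hC); constructor 2.
- by move/(_ _ hD); constructor 3.
Qed.

(** The class of [a] modulo the 210-th roots of unity takes at most one exponential from each
    cosine. A class of one term cannot vanish, two terms give two opposite cosines, three terms fall
    under [three_unit_sum] and leave a fourth cosine equal to 0, and four terms fall under
    [four_unit_sum]. *)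
Lemma four_cosines_free (F : numFieldType) N (z : F) a b c d :
    let x e := z ^+ e + z ^- e in
    N.-primitive_root z -> ~~ (N %| 420 * a)%N ->
    x a + x b + x c + x d = 0 ->
  [\/ x a + x b = 0, x a + x c = 0 | x a + x d = 0] \/
  [\/ x b = 0 /\ x a ^+ 2 + x c ^+ 2 + x d ^+ 2 = 6%:R,
      x c = 0 /\ x a ^+ 2 + x b ^+ 2 + x d ^+ 2 = 6%:R |
      x d = 0 /\ x a ^+ 2 + x b ^+ 2 + x c ^+ 2 = 6%:R].
Proof.
move=> x prz a_free sum0; have N_gt0 := prim_order_gt0 prz.
have z0 e : z ^+ e != 0 by rewrite expf_eq0 (prim_root_eq0 prz) eqn0Ngt N_gt0 andbF.
pose inv e := (N.-1 * e)%N.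
have zinv e : z ^+ inv e = z ^- e.
  apply: (mulIf (z0 e)); rewrite mulVf // -exprD /inv -mulSnr prednK //.
  by rewrite exprM (prim_expr_order prz) expr1n.
pose s := [:: a; inv a; b; inv b; c; inv c; d; inv d].
have s0 : \sum_(e <- s) z ^+ e = 0.
  by rewrite -[RHS]sum0 /s !big_cons big_nil !zinv /x; ring.
pose P e := (210 * e == 210 * a %[mod N])%N.
have sP0 : \sum_(e <- s | P e) z ^+ e = 0 by exact: vanishing_sum_split.
have prz' : N.-primitive_root z^-1.
  rewrite -[z^-1]/(z ^- 1) -zinv /inv muln1 prim_root_exp_coprime //.
  by rewrite -{2}(prednK N_gt0) coprimenS.
have sP0' : \sum_(e <- s | P e) z ^- e = 0.
  have := sP0; rewrite -big_filter => /(sum_prim_root_conj prz prz').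
  by rewrite big_filter; under eq_bigr do rewrite exprVn.
have nP e : P e -> ~~ P (inv e).
  move=> Pe; apply: contra a_free => Pe'.
  have : (210 * e + 210 * inv e == 210 * a + 210 * a %[mod N])%N.
    by rewrite -modnDm (eqP Pe) (eqP Pe') modnDm.
  rewrite -mulnDr /inv -mulSn prednK // mulnCA modnMr eq_sym addnn -mul2n mulnA.
  by [].
have Pa : P a by exact: eqxx.
(* [Y] is the contribution of [e] and [inv e] to the class of [a], and [Y'] that of their inverses;
   by [nP] the two exponents never contribute together. *)
have ya e : exists Y Y', [\/ [/\ Y = 0, Y' = 0,
     (if P e then z ^+ e else 0) + (if P (inv e) then z ^+ inv e else 0) = Y &
     (if P e then z ^- e else 0) + (if P (inv e) then z ^- inv e else 0) = Y'] |
   [/\ Y * Y' = 1, Y + Y' = x e,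
     (if P e then z ^+ e else 0) + (if P (inv e) then z ^+ inv e else 0) = Y &
     (if P e then z ^- e else 0) + (if P (inv e) then z ^- inv e else 0) = Y']].
  have [Pe|nPe] := boolP (P e).
    rewrite (negPf (nP e Pe)) !addr0; exists (z ^+ e), (z ^- e); right.
    by split=> //; rewrite divff.
  rewrite !add0r !zinv invrK; case: ifP => _.
    exists (z ^- e), (z ^+ e); right; split=> //; first by rewrite mulVf.
    by rewrite addrC.
  by exists 0, 0; left.
have [B [B' hB]] := ya b; have [C [C' hC]] := ya c; have [D [D' hD]] := ya d.
have sum1 : z ^+ a + B + C + D = 0.
  rewrite -[RHS]sP0 big_mkcond /s !big_cons big_nil Pa (negPf (nP a Pa)) /=.
  by case: hB hC hD => [] [_ _ <- _] [] [_ _ <- _] [] [_ _ <- _]; rewrite add0r addr0 !addrA.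
have sum2 : z ^- a + B' + C' + D' = 0.
  rewrite -[RHS]sP0' big_mkcond /s !big_cons big_nil Pa (negPf (nP a Pa)) /=.
  by case: hB hC hD => [] [_ _ _ <-] [] [_ _ _ <-] [] [_ _ _ <-]; rewrite add0r addr0 !addrA.
have hA : z ^+ a * z ^- a = 1 by rewrite divff.
have xaE : x a = z ^+ a + z ^- a by [].
have comb (p q r t : F) : q = 0 -> r = 0 -> t = 0 -> p = q - r - t -> p = 0.
  by move=> -> -> -> ->; rewrite !subr0.
move: (z0 a) sum1 sum2 hA xaE sum0.
move: (z ^+ a) (z ^- a) => A A' A0.
case: hB => [[B0 B0' _ _]|[hB <- _ _]]; case: hC => [[C0 C0' _ _]|[hC <- _ _]];
  case: hD => [[D0 D0' _ _]|[hD <- _ _]] s1 s2 hA -> sum0;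
  rewrite ?B0 ?B0' ?C0 ?C0' ?D0 ?D0' ?addr0 in s1 s2.
- by rewrite s1 eqxx in A0.
- by left; constructor 3; rewrite addrACA s1 s2 addr0.
- by left; constructor 2; rewrite addrACA s1 s2 addr0.
- right; constructor 1; split; last exact: three_unit_sum.
  by apply: (comb _ _ _ _ sum0 s1 s2); ring.
- by left; constructor 1; rewrite addrACA s1 s2 addr0.
- right; constructor 2; split; last exact: three_unit_sum.
  by apply: (comb _ _ _ _ sum0 s1 s2); ring.
- right; constructor 3; split; last exact: three_unit_sum.
  by apply: (comb _ _ _ _ sum0 s1 s2); ring.
- by left; exact: four_unit_sum.
Qed.

Lemma four_cosines (F : numFieldType) N (z : F) a b c d :
    let x e := z ^+ e + z ^- e in
    N.-primitive_root z -> x a + x b + x c + x d = 0 ->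
  [\/ [&& N %| 420 * a, N %| 420 * b, N %| 420 * c & N %| 420 * d]%N,
      [\/ x a + x b = 0, x a + x c = 0 | x a + x d = 0] |
      [\/ x a = 0 /\ x b ^+ 2 + x c ^+ 2 + x d ^+ 2 = 6%:R,
          x b = 0 /\ x a ^+ 2 + x c ^+ 2 + x d ^+ 2 = 6%:R,
          x c = 0 /\ x a ^+ 2 + x b ^+ 2 + x d ^+ 2 = 6%:R |
          x d = 0 /\ x a ^+ 2 + x b ^+ 2 + x c ^+ 2 = 6%:R]].
Proof.
move=> x prz sum0.
have other (p q r t : F) : p + q + r + t = 0 -> p + q = 0 -> r + t = 0.
  by move=> s0 pq; rewrite -s0 -addrA pq add0r.
have [ha|/(four_cosines_free prz)/(_ sum0)] := boolP (N %| 420 * a)%N; last first.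
  by case=> [|[]] h; [constructor 2 | constructor 3; constructor 2
    | constructor 3; constructor 3 | constructor 3; constructor 4].
have [hb|/(four_cosines_free prz) hb] := boolP (N %| 420 * b)%N; last first.
  have sum1 : x b + x a + x c + x d = 0 by rewrite [x b + _]addrC.
  case: (hb _ _ _ sum1) => [[h|h|h]|[h|h|h]].
  - by constructor 2; constructor 1; rewrite addrC.
  - constructor 2; constructor 3; apply: other h; rewrite -[RHS]sum1 /x; ring.
  - constructor 2; constructor 2; apply: other h; rewrite -[RHS]sum1 /x; ring.
  - by constructor 3; constructor 1.
  - by constructor 3; constructor 3; rewrite [x a ^+ 2 + _]addrC.
  - by constructor 3; constructor 4; rewrite [x a ^+ 2 + _]addrC.
have [hc|/(four_cosines_free prz) hc] := boolP (N %| 420 * c)%N; last first.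
  have sum1 : x c + x a + x b + x d = 0 by rewrite -[RHS]sum0 /x; ring.
  case: (hc _ _ _ sum1) => [[h|h|h]|[[h1 h2]|[h1 h2]|[h1 h2]]].
  - by constructor 2; constructor 2; rewrite addrC.
  - constructor 2; constructor 3; apply: other h; rewrite -[RHS]sum1 /x; ring.
  - constructor 2; constructor 1; apply: other h; rewrite -[RHS]sum1 /x; ring.
  - by constructor 3; constructor 1; split=> //; rewrite -h2 /x; ring.
  - by constructor 3; constructor 2; split=> //; rewrite -h2 /x; ring.
  - by constructor 3; constructor 4; split=> //; rewrite -h2 /x; ring.
have [hd|/(four_cosines_free prz) hd] := boolP (N %| 420 * d)%N; last first.
  have sum1 : x d + x a + x b + x c = 0 by rewrite -[RHS]sum0 /x; ring.
  case: (hd _ _ _ sum1) => [[h|h|h]|[[h1 h2]|[h1 h2]|[h1 h2]]].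
  - by constructor 2; constructor 3; rewrite addrC.
  - constructor 2; constructor 2; apply: other h; rewrite -[RHS]sum1 /x; ring.
  - constructor 2; constructor 1; apply: other h; rewrite -[RHS]sum1 /x; ring.
  - by constructor 3; constructor 1; split=> //; rewrite -h2 /x; ring.
  - by constructor 3; constructor 2; split=> //; rewrite -h2 /x; ring.
  - by constructor 3; constructor 3; split=> //; rewrite -h2 /x; ring.
by constructor 1; apply/and4P; split.
Qed.

(** * Reduction modulo an integer and the finite problem at level 420 *)

Lemma gcd_mul_eq1 (q x y u : Z) :
  Z.gcd q (Z.mul x y) = Zpos xH -> Z.gcd q u = Zpos xH ->
  Z.gcd q (Z.mul x u) = Zpos xH.
Proof.
move=> gcd_xy gcd_u; set g := Z.gcd q _.
have g_q : Z.divide g q := Z.gcd_divide_l _ _.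
have g_xu : Z.divide g (Z.mul x u) := Z.gcd_divide_r _ _.
have unit1 d : Z.le Z0 d -> Z.divide d (Zpos xH) -> d = Zpos xH by exact: Z.divide_1_r_nonneg.
have gcd_gx : Z.gcd g x = Zpos xH.
  apply: unit1; first exact: Z.gcd_nonneg.
  rewrite -gcd_xy; apply: Z.gcd_greatest.
    exact: Z.divide_trans (Z.gcd_divide_l _ _) g_q.
  exact: Z.divide_trans (Z.gcd_divide_r _ _) (Z.divide_factor_l _ _).
apply: unit1; first exact: Z.gcd_nonneg.
rewrite -gcd_u; apply: Z.gcd_greatest g_q _.
exact: Z.gauss g_xu gcd_gx.
Qed.

(** A proper divisor [d] of [N] divides some [N / p], so ['Phi_d] at [h] divides [h ^+ (N / p) - 1]
    and is prime to [q]; in the factorisation of [h ^+ N - 1] only the factor ['Phi_N] remains. The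
    gcd conditions take the place of a primality proof for [q] and can be computed. *)
Lemma dvd_horner_Cyclotomic N (h q : Z) :
    (0 < N)%N -> Z.divide q (h ^+ N - 1)%R ->
    (forall p, prime p -> (p %| N)%N -> Z.gcd q (h ^+ (N %/ p) - 1)%R = 1) ->
  Z.divide q (map_poly intr 'Phi_N).[h].
Proof.
move=> N_gt0 qN coprime_q.
have prodE m := @prod_horner_Cyclotomic Z m h.
have N_div : N \in divisors N by rewrite -dvdn_divisors.
rewrite -prodE // (big_rem N) //= mulrC in qN.
apply: Z.gauss qN _.
have : all (fun d => d %| N)%N (rem N (divisors N)).
  by apply/allP => d /mem_rem; rewrite -dvdn_divisors.
have : N \notin rem N (divisors N) by rewrite mem_rem_uniqF ?divisors_uniq.
elim: (rem _ _) => [|d s IHs]; first by rewrite big_nil Z.gcd_1_r.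
rewrite inE negb_or eq_sym big_cons => /andP[d_neq N_s] /= /andP[d_N s_N].
have [p pr_p p_dvd] : exists2 p, prime p & (p %| N %/ d)%N.
  exists (pdiv (N %/ d)); last exact: pdiv_dvd.
  apply: pdiv_prime; rewrite ltn_divRL // mul1n ltn_neqAle d_neq.
  exact: dvdn_leq.
have pd_N : (d * p %| N)%N by rewrite -(divnK d_N) mulnC dvdn_mul.
have p_N : (p %| N)%N := dvdn_trans (dvdn_mull _ (dvdnn p)) pd_N.
have d_Np : (d %| N %/ p)%N by rewrite dvdn_divRL // mulnC.
have Np_gt0 : (0 < N %/ p)%N by rewrite divn_gt0 ?prime_gt0 // dvdn_leq.
have := coprime_q p pr_p p_N.
rewrite -prodE // (big_rem d) /=; last by rewrite -dvdn_divisors.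
by move=> gcd_d; exact: gcd_mul_eq1 gcd_d (IHs N_s s_N).
Qed.

(* Equal keys are separated from the others one binary digit at a time, so that
   the number of comparisons stays almost linear in the length of the list. *)
Fixpoint same_key_check (T : Type) (r : T -> T -> bool) n (l : seq (Z * T)) :=
  match l with
  | [::] => true
  | [:: _] => true
  | _ => if n is n'.+1 then
      same_key_check r n' [seq (Z.div2 x.1, x.2) | x <- [seq y <- l | Z.odd y.1]] &&
      same_key_check r n' [seq (Z.div2 x.1, x.2) | x <- [seq y <- l | ~~ Z.odd y.1]]
    else all (fun x => all (fun y => r x.2 y.2) l) l
  end.

(** Reflexivity of [r] accounts for the buckets with a single entry, where nothing is compared. *)
Lemma same_key_checkP (T : eqType) (r : rel T) n (l : seq (Z * T)) x y :
    reflexive r -> same_key_check r n l ->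
    x \in l -> y \in l -> x.1 = y.1 -> r x.2 y.2.
Proof.
move=> r_refl; elim: n => [|n IHn] in l x y *.
  case: l => // u [_|v l].
    by rewrite !inE => /eqP-> /eqP-> _; exact: r_refl.
  by move=> /allP h xl yl _; have /allP := h x xl; apply.
case: l => // u [_|v l].
  by rewrite !inE => /eqP-> /eqP-> _; exact: r_refl.
set l0 := u :: v :: l.
pose l1 := [seq (Z.div2 z.1, z.2) | z <- [seq y <- l0 | Z.odd y.1]].
pose l2 := [seq (Z.div2 z.1, z.2) | z <- [seq y <- l0 | ~~ Z.odd y.1]].
rewrite -[same_key_check _ _ _]/(same_key_check r n l1 && same_key_check r n l2).
have sub1 z : z \in l0 -> Z.odd z.1 -> (Z.div2 z.1, z.2) \in l1.
  by move=> zl odd_z; apply/mapP; exists z => //; rewrite mem_filter odd_z.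
have sub2 z : z \in l0 -> ~~ Z.odd z.1 -> (Z.div2 z.1, z.2) \in l2.
  by move=> zl odd_z; apply/mapP; exists z => //; rewrite mem_filter odd_z.
case/andP=> chk1 chk2 xl yl eq_key.
have [odd_x|even_x] := boolP (Z.odd x.1).
  apply: (IHn l1 (Z.div2 x.1, x.2) (Z.div2 y.1, y.2) chk1) => /=; last by rewrite eq_key.
    exact: sub1.
  by apply: sub1; rewrite -?eq_key.
apply: (IHn l2 (Z.div2 x.1, x.2) (Z.div2 y.1, y.2) chk2) => /=; last by rewrite eq_key.
  exact: sub2.
by apply: sub2; rewrite -?eq_key.
Qed.

Definition powers_mod (q h : Z) N : seq Z :=
  traject (fun x => Z.modulo (Z.mul h x) q) (Zpos xH) N.+1.

Lemma nth_powers_mod q h N n : q <> Z0 -> (n <= N)%N ->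
  Z.modulo (nth Z0 (powers_mod q h N) n) q = Z.modulo (h ^+ n) q.
Proof.
move=> q0 le_n; rewrite (set_nth_default (Zpos xH)) ?size_traject //.
rewrite nth_traject //; elim: n {le_n} => // n IHn.
rewrite iterS exprS Z.mod_mod // -Z.mul_mod_idemp_r // IHn.
by rewrite Z.mul_mod_idemp_r.
Qed.

Definition prim_root_mod (q h : Z) N :=
  let pred_power n := Z.modulo (Z.sub (nth Z0 (powers_mod q h N) n) (Zpos xH)) q in
  (pred_power N == Z0) &&
  all (fun p => Z.gcd q (pred_power (N %/ p)%N) == Zpos xH) (primes N).

Lemma prim_root_mod_transfer (F : numFieldType) N (z : F) (q h : Z) (P : {poly int}) :
    q <> Z0 -> prim_root_mod q h N ->
    N.-primitive_root z -> (map_poly intr P).[z] = 0 ->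
  Z.divide q (map_poly intr P).[h].
Proof.
move=> q0 /andP[/eqP hN /allP hp] prz /(dvd_Cyclotomic prz)[r ->].
have predE n : (n <= N)%N ->
    Z.modulo (Z.sub (nth Z0 (powers_mod q h N) n) (Zpos xH)) q =
    Z.modulo (h ^+ n - 1)%R q.
  move=> le_n; rewrite -[RHS]/(Z.modulo (Z.sub _ _) _) Zminus_mod.
  by rewrite nth_powers_mod // -Zminus_mod.
have N_gt0 := prim_order_gt0 prz.
rewrite rmorphM hornerM; apply: Z.divide_mul_r; apply: dvd_horner_Cyclotomic => //.
  by apply/(Z.mod_divide _ _ q0); rewrite -predE.
move=> p pr_p p_dvd; move: (hp p).
rewrite mem_primes pr_p N_gt0 => /(_ p_dvd)/eqP; rewrite predE ?leq_div //.
by rewrite Z.gcd_comm Z.gcd_mod // => ->.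
Qed.

(** Reversal pairs [h ^+ n] with [h ^+ (N - n)], the inverse of [h ^+ n]: entry [n] is the residue
    of 2 cos(2 n pi/N). For this the list of powers runs up to [h ^+ N] inclusive. *)
Definition cosines_mod q h N : seq Z :=
  let pw := powers_mod q h N in
  [seq Z.modulo (Z.add u.1 u.2) q | u <- zip pw (rev pw)].

Lemma nth_cosines_mod q h N n : q <> Z0 -> (n <= N)%N ->
  Z.modulo (nth Z0 (cosines_mod q h N) n) q =
  Z.modulo (h ^+ n + h ^+ (N - n))%R q.
Proof.
move=> q0 le_n; have size_pw : size (powers_mod q h N) = N.+1 by rewrite size_traject.
rewrite (nth_map (Z0, Z0)) ?size_zip ?size_rev ?size_pw ?minnn // nth_zip ?size_rev //=.
rewrite Z.mod_mod // Z.add_mod // nth_rev ?size_pw // subSS.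
by rewrite !nth_powers_mod ?leq_subr // -Z.add_mod.
Qed.

(* The pair {j, s}, s = j + 2 e, stands for 2 sin(j pi/N) sin(s pi/N), which is
   the difference of two cosines. *)
Definition pair_keys N q (c : seq Z) : seq (Z * (nat * nat)) :=
  flatten [seq [seq
      (Z.modulo (Z.sub (nth Z0 c e) (nth Z0 c (j + e))) q, (j, j + 2 * e)%N)
    | e <- iota 0 ((N %/ 2 - j) %/ 2).+1] | j <- iota 1 (N %/ 2)].

Lemma cosine_collisions (F : numFieldType) N (z : F) q h (r : rel (nat * nat)) fuel j e i f :
    let x n := z ^+ n + z ^- n in
    q <> Z0 -> prim_root_mod q h N -> reflexive r ->
    same_key_check r fuel (pair_keys N q (cosines_mod q h N)) ->
    N.-primitive_root z ->
    (0 < j)%N -> (j + 2 * e <= N %/ 2)%N -> (0 < i)%N -> (i + 2 * f <= N %/ 2)%N ->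
    x e - x (j + e)%N = x f - x (i + f)%N ->
  r (j, j + 2 * e)%N (i, i + 2 * f)%N.
Proof.
move=> x q0 prh r_refl chk prz j_gt0 le_je i_gt0 le_if eq_x.
have N2 := leq_div N 2.
(* [z ^- n] is written [z ^+ (N - n)], so that the relation becomes an integer polynomial in [z]. *)
pose P n : {poly int} := 'X^n + 'X^(N - n).
have Pz n : (n <= N)%N -> (map_poly intr (P n)).[z] = x n.
  move=> le_n; rewrite rmorphD /= !map_polyXn !hornerE /x; congr (_ + _).
  rewrite expfB_cond ?(prim_expr_order prz) ?mul1r //.
  by rewrite (prim_root_eq0 prz) eqn0Ngt (prim_order_gt0 prz).
have Ph n : (map_poly intr (P n)).[h] = h ^+ n + h ^+ (N - n).
  by rewrite rmorphD /= !map_polyXn !hornerE.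
pose c := cosines_mod q h N.
pose key d n := (Z.modulo (Z.sub (nth Z0 c d) (nth Z0 c (n + d))) q, (n, n + 2 * d)%N).
have key_mem n d : (0 < n)%N -> (n + 2 * d <= N %/ 2)%N -> key d n \in pair_keys N q c.
  move=> n_gt0 le_nd; apply/flatten_mapP; exists n; first by rewrite mem_iota; lia.
  by apply/mapP; exists d => //; rewrite mem_iota; lia.
apply: (same_key_checkP r_refl chk (key_mem j e _ _) (key_mem i f _ _)) => //.
have keyE d n : (n + 2 * d <= N %/ 2)%N -> (key d n).1 =
    Z.modulo ((map_poly intr (P d)).[h] - (map_poly intr (P (n + d)%N)).[h])%R q.
  move=> le_nd; rewrite !Ph /= Zminus_mod !nth_cosines_mod //; try lia.
  by rewrite -Zminus_mod.
rewrite !keyE //.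
have /(prim_root_mod_transfer q0 prh prz) :
    (map_poly intr (P e - P (j + e)%N - (P f - P (i + f)%N))).[z] = 0.
  by rewrite !rmorphB !hornerE /= !Pz; try lia; rewrite eq_x subrr.
rewrite !rmorphB !hornerE /=.
move: ((map_poly _ (P e)).[h] - _) ((map_poly _ (P f)).[h] - _) => u v /(Z.mod_divide _ _ q0).
rewrite -[GRing.add _ _]/(Z.sub u v) => eq_uv.
by rewrite -[u](Z.sub_add v) -Z.add_mod_idemp_l // eq_uv.
Qed.

Definition sporadic30 : seq quad :=
  [:: Quad 1 3 3 11; Quad 3 5 5 9; Quad 7 9 9 13; Quad 1 2 4 9; Quad 2 3 5 8;
      Quad 8 9 11 14; Quad 2 3 7 14; Quad 3 4 8 13; Quad 4 5 9 14].
Definition sporadic42 : seq quad :=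
  [:: Quad 2 3 9 16; Quad 3 4 10 15; Quad 8 9 15 20].
Definition sporadic60 : seq quad :=
  [:: Quad 3 4 16 27; Quad 5 6 18 25; Quad 8 9 21 28].
Definition scale_quad m q := Quad (m * qi q) (m * qj q) (m * qs q) (m * qt q).
(** The list for k = 420 = 6 * 70 = 30 * 14 = 42 * 10 = 60 * 7. *)
Definition listed420 : seq quad :=
  [seq Quad u 70 (2 * u) (210 - u) | u <- iota 1 105 & u != 70%N] ++
  map (scale_quad 14) sporadic30 ++ map (scale_quad 10) sporadic42 ++
  map (scale_quad 7) sporadic60.

Definition same_pair (x y : nat * nat) :=
  (x.1 == y.1) && (x.2 == y.2) || (x.1 == y.2) && (x.2 == y.1).
Definition quad_match (x y : nat * nat) q :=
  same_pair x (qj q, qs q) && same_pair y (qi q, qt q).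
(** Unordered pairs absorb the permutations (i,t) and (j,s), and the two orders of [x] and [y]
    absorb (i,j)(s,t). The maps kappa_m do not occur, since all entries considered are at most
    210. *)
Definition known_collision (x y : nat * nat) :=
  [|| same_pair x y, has (quad_match x y) listed420 | has (quad_match y x) listed420].

(* The prime 5014381 = 1 mod 420 and the element 1364995 of order 420 were found
   by search: they create no collision that does not already hold over C. *)
Lemma cosine_collisions420 (F : numFieldType) (z : F) j e i f :
    let x n := z ^+ n + z ^- n in
    420.-primitive_root z ->
    (0 < j)%N -> (j + 2 * e <= 210)%N -> (0 < i)%N -> (i + 2 * f <= 210)%N ->
    x e - x (j + e)%N = x f - x (i + f)%N ->
  known_collision (j, j + 2 * e)%N (i, i + 2 * f)%N.
Proof.
have r_refl : reflexive known_collision.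
  by move=> u; apply/orP; left; rewrite /same_pair !eqxx.
pose q := Z.of_N 5014381; pose h := Z.of_N 1364995.
have q0 : q <> Z0 by [].
have prh : prim_root_mod q h 420 by vm_compute.
(* The modulus has 23 binary digits, so fuel 24 suffices to separate all distinct keys. *)
have chk : same_key_check known_collision 24 (pair_keys 420 q (cosines_mod q h 420)).
  by vm_compute.
exact: (@cosine_collisions F 420 z q h known_collision 24 j e i f q0 prh r_refl chk).
Qed.

(** * Overlaps as equal products of sines *)

Definition angle (R : realType) k n : R := pi * n%:R / k%:R.

Lemma angleD (R : realType) k m n : angle R k (m + n) = angle R k m + angle R k n.
Proof. by rewrite /angle natrD mulrDr mulrDl. Qed.

Lemma angle_itv (R : realType) k n : (0 < n)%N -> (n < k)%N -> 0 < angle R k n < pi.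
Proof.
move=> n_gt0 lt_n; have k_gt0 : (0 < k)%N by apply: leq_ltn_trans lt_n.
rewrite /angle divr_gt0 ?mulr_gt0 ?pi_gt0 ?ltr0n //=.
by rewrite ltr_pdivrMr ?ltr0n // ltr_pM2l ?pi_gt0 // ltr_nat.
Qed.

Lemma sin_angle_gt0 (R : realType) k n :
  (0 < n)%N -> (n < k)%N -> 0 < sin (angle R k n).
Proof. by move=> n_gt0 lt_n; exact/sin_gt0_pi/angle_itv. Qed.

Lemma sin_angle_compl (R : realType) k n :
  (n <= k)%N -> (0 < k)%N -> sin (angle R k (k - n)) = sin (angle R k n).
Proof.
move=> le_n k_gt0; have -> : angle R k (k - n) = - angle R k n + pi.
  rewrite /angle natrB // mulrBr mulrBl mulfK ?pnatr_eq0 -?lt0n //.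
  by rewrite addrC.
by rewrite sinDpi sinN opprK.
Qed.

Lemma sinM_cosB (R : realType) (a b : R) :
  2 * (sin a * sin b) = cos (a - b) - cos (a + b).
Proof. rewrite cosB cosD; ring. Qed.

Lemma phi_double_exp (R : realType) k n :
  phi R (2 * k) ^+ n = Complex (cos (angle R k n)) (sin (angle R k n)).
Proof.
elim: n => [|n IHn]; first by rewrite /angle mulr0 mul0r cos0 sin0.
rewrite exprS {}IHn -[n.+1]add1n angleD cosD sinD /phi.
suff -> : 2 * pi / (2 * k)%:R = angle R k 1 by apply/eqP; rewrite eq_complex /= eqxx /= addrC.
rewrite natrM /angle mulr1 -mulf_div divff ?mul1r //.
by rewrite pnatr_eq0.
Qed.

Lemma phi_double_sqr (R : realType) k : phi R (2 * k) ^+ 2 = phi R k.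
Proof.
rewrite phi_double_exp /angle /phi; congr Complex; congr (_ _); ring.
Qed.

Lemma phi_prim_root (R : realType) k : (0 < k)%N -> k.-primitive_root (phi R k).
Proof.
move=> k_gt0.
have expE n : phi R k ^+ n = Complex (cos (angle R k (2 * n))) (sin (angle R k (2 * n))).
  by rewrite -phi_double_sqr -exprM phi_double_exp.
have phik : phi R k ^+ k = 1.
  rewrite expE /angle natrM mulrA mulfK ?pnatr_eq0 -?lt0n // mulr_natr.
  by rewrite cos2pi sin2pi.
have [m prm m_k] := prim_order_exists k_gt0 phik.
suff mk : m = k by rewrite mk in prm.
apply/eqP; rewrite eqn_leq (dvdn_leq k_gt0 m_k) leqNgt; apply/negP => lt_m.
have := prim_expr_order prm; rewrite expE => -[/eqP].
rewrite mul2n -addnn angleD -mulr2n cos_mulr2n cos2sin2 => /eqP cos1 _.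
have := sin_angle_gt0 R (prim_order_gt0 prm) lt_m.
move: (sin _) cos1 => s cos1 s_gt0.
have : 0 < s ^+ 2 by rewrite exprn_gt0.
by rewrite mulr2n in cos1; lra.
Qed.

Lemma phi_exp_sub1 (R : realType) k n :
  phi R k ^+ n - 1 = phi R (2 * k) ^+ n * Complex 0 (2 * sin (angle R k n)).
Proof.
rewrite -phi_double_sqr exprAC phi_double_exp.
have := cos2Dsin2 (angle R k n); move: (cos _) (sin _) => c s cs1.
by apply/eqP; rewrite eq_complex /=; apply/andP; split; apply/eqP; nra.
Qed.

Lemma phi_double_sum_inv (R : realType) k n :
  phi R (2 * k) ^+ n + phi R (2 * k) ^- n = real_complex R (2 * cos (angle R k n)).
Proof.
rewrite phi_double_exp; have := cos2Dsin2 (angle R k n).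
move: (cos _) (sin _) => c s cs1.
rewrite /real_complex_def; apply/eqP; rewrite eq_complex /= cs1 !divr1.
by apply/andP; split; apply/eqP; ring.
Qed.

(** Each factor [phi ^+ n - 1] is 2i sin(n pi/k) times the n-th power of the square root
    [phi R (2 * k)] of [phi R k], and the constant (2i)^2 = -4 cancels. The free scalar [u] serves
    for natural as well as integer powers of [phi]. *)
Lemma overlap_eqE (R : realType) k i j s t (u v : R[i]) :
  let sn n := sin (angle R k n) in
  (u * (phi R k ^+ j - 1) * (phi R k ^+ s - 1) =
   v * (phi R k ^+ i - 1) * (phi R k ^+ t - 1)) <->
  (u * phi R (2 * k) ^+ (j + s) * real_complex R (sn j * sn s) =
   v * phi R (2 * k) ^+ (i + t) * real_complex R (sn i * sn t)).
Proof.
move=> sn; have factorE w m n : w * (phi R k ^+ m - 1) * (phi R k ^+ n - 1) =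
    - 4%:R * (w * phi R (2 * k) ^+ (m + n) * real_complex R (sn m * sn n)).
  rewrite !phi_exp_sub1 exprD -/(sn m) -/(sn n).
  have -> : Complex 0 (2 * sn m) = 'i%C * 2 * real_complex R (sn m).
    by apply/eqP; rewrite eq_complex /=; apply/andP; split; apply/eqP; ring.
  have -> : Complex 0 (2 * sn n) = 'i%C * 2 * real_complex R (sn n).
    by apply/eqP; rewrite eq_complex /=; apply/andP; split; apply/eqP; ring.
  rewrite rmorphM /=.
  have i2 : 'i%C * 'i%C = -1 :> R[i].
    by apply/eqP; rewrite eq_complex /=; apply/andP; split; apply/eqP; ring.
  move: (phi _ _ ^+ m) (phi _ _ ^+ n) (real_complex _ _) (real_complex _ _) => a b c d.
  transitivity (('i%C * 'i%C) * (4 * (w * (a * b) * (c * d)))); first by ring.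
  by rewrite i2; ring.
rewrite !factorE; split=> [|->//]; apply: mulfI.
by rewrite oppr_eq0 pnatr_eq0.
Qed.

Lemma norm_prim_root (F : numFieldType) n (z : F) : n.-primitive_root z -> `|z| = 1.
Proof.
move=> prz; apply/eqP; have /(congr1 Num.norm)/eqP := prim_expr_order prz.
by rewrite normrX normr1 pexprn_eq1 // eqn0Ngt (prim_order_gt0 prz).
Qed.

(** Absolute values isolate the identity between the positive sines. What remains is
    [2 w + j + s = i + t] modulo [2 k], which has a solution [w] exactly when the sum of the entries
    is even. *)
Lemma nontriv_overlapE (R : realType) k q : (0 < k)%N ->
    let sn n := sin (angle R k n) in
  nontriv_overlap R k q <->
  [/\ in_k4 k q, ~~ trivial_quad k q, ~~ odd (qi q + qj q + qs q + qt q) &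
      sn (qj q) * sn (qs q) = sn (qi q) * sn (qt q)].
Proof.
move=> k_gt0 sn; case: q => i j s t; rewrite /nontriv_overlap /is_overlap /=.
have prz : (2 * k).-primitive_root (phi R (2 * k)) by rewrite phi_prim_root ?muln_gt0.
have sn_gt0 n : in_k k n -> 0 < sn n.
  by case/andP=> ? ?; apply: sin_angle_gt0; lia.
have eqE w : (phi R k ^+ w * (phi R k ^+ j - 1) * (phi R k ^+ s - 1) =
     (phi R k ^+ i - 1) * (phi R k ^+ t - 1)) <->
   (phi R (2 * k) ^+ (2 * w + (j + s)) * real_complex R (sn j * sn s) =
    phi R (2 * k) ^+ (i + t) * real_complex R (sn i * sn t)).
  have := overlap_eqE k i j s t (phi R k ^+ w) 1; rewrite !mul1r.
  by rewrite [_ ^+ (2 * w + _)]exprD exprM phi_double_sqr.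
split.
  case=> -[in_q [_ [w [lt_w /eqE eq_w]]]] nontriv.
  have sn_eq : sn j * sn s = sn i * sn t.
    have /eqP := congr1 Num.norm eq_w.
    rewrite !normrM !normrX (norm_prim_root prz) !expr1n !mul1r.
    case/and4P: in_q => /= /sn_gt0 hi /sn_gt0 hj /sn_gt0 hs /sn_gt0 ht.
    by rewrite !ger0_norm ?lecR ?mulr_ge0 ?ltW // => /eqP/complexI.
  split=> //; have : (2 * w + (j + s) == i + t %[mod 2 * k])%N.
    rewrite -(eq_prim_root_expr prz); apply/eqP.
    move: eq_w; rewrite sn_eq; apply: mulIf.
    case/and4P: in_q => /= /sn_gt0 hi _ _ /sn_gt0 ht.
    by rewrite gt_eqF // ltcR mulr_gt0.
  move=> /eqP/(congr1 (modn^~ 2)); rewrite !modn_dvdm ?dvdn_mulr //.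
  by rewrite !modn2; lia.
case=> in_q nontriv even_q sn_eq; split=> //; split=> //; split.
  by move=> eq_is; case/negP: nontriv; rewrite /trivial_quad /= eq_is /pm_cong eqxx !orbT.
case/and4P: in_q => /= /andP[i1 i2] /andP[j1 j2] /andP[s1 s2] /andP[t1 t2].
(* The summand [2 * k] keeps the subtraction from being truncated. *)
pose w := ((i + t + 2 * k - (j + s)) %/ 2)%N.
have wE : (2 * w = i + t + 2 * k - (j + s))%N by rewrite /w; lia.
exists (w %% k)%N; split; first by rewrite ltn_mod.
rewrite (prim_expr_mod (phi_prim_root R k_gt0)); apply/eqE; rewrite sn_eq.
congr (_ * _); rewrite wE subnK; last by lia.
by rewrite exprD (prim_expr_order prz) mulr1.
Qed.

Lemma overlap_ratio (R : realType) k (i j s t : nat) (w : int) : (0 < k)%N ->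
    let sn n := sin (angle R k n) in
    (0 < i < k)%N -> (0 < s < k)%N -> sn j * sn s = sn i * sn t ->
    2 * w = (t + i)%N%:Z - (s + j)%N%:Z ->
  phi R k ^ w * ((phi R k ^+ j - 1) / (phi R k ^+ i - 1)) =
    (phi R k ^+ t - 1) / (phi R k ^+ s - 1).
Proof.
move=> k_gt0 sn lt_i lt_s sn_eq w_eq.
have prz := phi_prim_root R k_gt0.
have prz2 : (2 * k).-primitive_root (phi R (2 * k)) by rewrite phi_prim_root ?muln_gt0.
have sub1_neq0 n : (0 < n < k)%N -> phi R k ^+ n - 1 != 0.
  move=> lt_n; rewrite subr_eq0 -[1](expr0 (phi R k)) (eq_prim_root_expr prz).
  by rewrite mod0n modn_small; lia.
have := sub1_neq0 _ lt_i; have := sub1_neq0 _ lt_s.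
have eqz : phi R (2 * k) ^+ (t + i) = phi R k ^ w * phi R (2 * k) ^+ (s + j).
  have z0 : phi R (2 * k) != 0 by rewrite (prim_root_eq0 prz2); lia.
  rewrite -(phi_double_sqr R k) !exprnP exprz_exp -expfzDr //; congr (_ ^ _); lia.
have /overlap_eqE : phi R k ^ w * phi R (2 * k) ^+ (j + s) * real_complex R (sn j * sn s) =
    1 * phi R (2 * k) ^+ (i + t) * real_complex R (sn i * sn t).
  by rewrite sn_eq [(j + s)%N]addnC -eqz mul1r [(t + i)%N]addnC.
rewrite mul1r; move: (phi R k ^ w) (_ ^+ i - 1) (_ ^+ j - 1) (_ ^+ s - 1) (_ ^+ t - 1).
move=> u xi xj xs xt eq_u xs0 xi0.
transitivity (u * xj * xs / (xi * xs)); first by field; rewrite xi0 xs0.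
by rewrite eq_u; field; rewrite xi0 xs0.
Qed.

(** * The listed quadruples are nontrivial overlaps *)

Lemma nontriv_overlapI (R : realType) k i j s t w :
    (w < k)%N -> in_k4 k (Quad i j s t) -> ~~ trivial_quad k (Quad i j s t) ->
    phi R k ^+ w * (phi R k ^+ j - 1) * (phi R k ^+ s - 1) =
      (phi R k ^+ i - 1) * (phi R k ^+ t - 1) ->
  nontriv_overlap R k (Quad i j s t).
Proof.
move=> lt_w in_q nontriv eq_w; split; last exact: nontriv.
split; first exact: in_q.
split; last by exists w.
move=> /= eq_is; case/negP: nontriv.
by rewrite /trivial_quad /= eq_is /pm_cong eqxx !orbT.
Qed.

(** The polynomial is Phi_30, obtained from (y^15 + 1)(y + 1) = (y^5 + 1)(y^3 + 1) Phi_30(y): here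
    [y ^+ 15 = -1], while the two factors on the right are nonzero. *)
Lemma prim_root30_eq (F : numFieldType) (y : F) : 30.-primitive_root y ->
  y ^+ 8 + y ^+ 7 - y ^+ 5 - y ^+ 4 - y ^+ 3 + y + 1 = 0.
Proof.
move=> pry; set p := (X in X = 0).
have y15 : y ^+ 15 + 1 = 0.
  have neq : y ^+ 15 - 1 != 0 by rewrite subr_eq0 -(expr0 y) (eq_prim_root_expr pry).
  apply: (mulfI neq); rewrite mulr0 -(subrr (y ^+ 30)) {2}(prim_expr_order pry); ring.
have neq n : ~~ (n * 2 == 0 %[mod 30])%N -> y ^+ n + 1 != 0.
  apply: contra; rewrite addr_eq0 => /eqP yn; rewrite -(eq_prim_root_expr pry) expr0 exprM yn.
  by rewrite sqrrN expr1n.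
apply: (mulfI (neq 5%N isT)); apply: (mulfI (neq 3%N isT)).
transitivity ((y ^+ 15 + 1) * (y + 1)); first by rewrite /p; ring.
by rewrite y15 !mulr0 mul0r.
Qed.

(* The factors below are the quotients of the overlap relation, as a polynomial
   in y, by the cyclotomic polynomial of level 30, 42 or 60. *)
Lemma sporadic30_nontriv (R : realType) : List.Forall (nontriv_overlap R 30) sporadic30.
Proof.
set y := phi R 30; have Phi0 := prim_root30_eq (phi_prim_root R (isT : (0 < 30)%N)).
have overlap i j s t w cofactor :
    (w < 30)%N -> in_k4 30 (Quad i j s t) -> ~~ trivial_quad 30 (Quad i j s t) ->
    y ^+ w * (y ^+ j - 1) * (y ^+ s - 1) = (y ^+ i - 1) * (y ^+ t - 1)
      + (y ^+ 8 + y ^+ 7 - y ^+ 5 - y ^+ 4 - y ^+ 3 + y + 1) * cofactor ->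
    nontriv_overlap R 30 (Quad i j s t).
  by move=> lt_w in_q nontriv; rewrite Phi0 mul0r addr0; exact: nontriv_overlapI.
move: y {Phi0} overlap => y overlap.
repeat apply: List.Forall_cons; last exact: List.Forall_nil.
- apply: (overlap _ _ _ _ 3%N
    (- y ^+ 4 + 2 * y ^+ 3 - 2 * y ^+ 2 + 2 * y - 1)) => //; ring.
- apply: (overlap _ _ _ _ 1%N
    (- y ^+ 4 + 2 * y ^+ 3 - 2 * y ^+ 2 + 2 * y - 1)) => //; ring.
- apply: (overlap _ _ _ _ 1%N
    (- y ^+ 12 + 2 * y ^+ 11 - 2 * y ^+ 10 + y ^+ 9 - y ^+ 7 + 2 * y ^+ 6 - y ^+ 5
     + y ^+ 3 - 2 * y ^+ 2 + 2 * y - 1)) => //; ring.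
- apply: (overlap _ _ _ _ 2%N (- y ^+ 2 + 2 * y - 1)) => //; ring.
- apply: (overlap _ _ _ _ 1%N (- y ^+ 2 + 2 * y - 1)) => //; ring.
- apply: (overlap _ _ _ _ 1%N
    (- y ^+ 14 + 2 * y ^+ 13 - 2 * y ^+ 12 + y ^+ 11 - y ^+ 9 + 2 * y ^+ 8
     - 2 * y ^+ 7 + 2 * y ^+ 6 - y ^+ 5 + y ^+ 3 - 2 * y ^+ 2 + 2 * y - 1)) => //; ring.
- apply: (overlap _ _ _ _ 3%N (- y ^+ 8 + y ^+ 7 + y - 1)) => //; ring.
- apply: (overlap _ _ _ _ 2%N (- y ^+ 8 + y ^+ 7 + y - 1)) => //; ring.
- apply: (overlap _ _ _ _ 2%N
    (- y ^+ 10 + y ^+ 9 - y ^+ 7 + 2 * y ^+ 6 - 2 * y ^+ 5 + 2 * y ^+ 4 - y ^+ 3 + y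
     - 1)) => //; ring.
Qed.

Lemma prim_root42_eq (F : numFieldType) (y : F) : 42.-primitive_root y ->
  y ^+ 12 + y ^+ 11 - y ^+ 9 - y ^+ 8 + y ^+ 6 - y ^+ 4 - y ^+ 3 + y + 1 = 0.
Proof.
move=> pry; set p := (X in X = 0).
have y21 : y ^+ 21 + 1 = 0.
  have neq : y ^+ 21 - 1 != 0 by rewrite subr_eq0 -(expr0 y) (eq_prim_root_expr pry).
  apply: (mulfI neq); rewrite mulr0 -(subrr (y ^+ 42)) {2}(prim_expr_order pry); ring.
have neq n : ~~ (n * 2 == 0 %[mod 42])%N -> y ^+ n + 1 != 0.
  apply: contra; rewrite addr_eq0 => /eqP yn; rewrite -(eq_prim_root_expr pry) expr0 exprM yn.
  by rewrite sqrrN expr1n.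
apply: (mulfI (neq 7%N isT)); apply: (mulfI (neq 3%N isT)).
transitivity ((y ^+ 21 + 1) * (y + 1)); first by rewrite /p; ring.
by rewrite y21 !mulr0 mul0r.
Qed.

Lemma sporadic42_nontriv (R : realType) : List.Forall (nontriv_overlap R 42) sporadic42.
Proof.
set y := phi R 42; have Phi0 := prim_root42_eq (phi_prim_root R (isT : (0 < 42)%N)).
have overlap i j s t w cofactor :
    (w < 42)%N -> in_k4 42 (Quad i j s t) -> ~~ trivial_quad 42 (Quad i j s t) ->
    y ^+ w * (y ^+ j - 1) * (y ^+ s - 1) = (y ^+ i - 1) * (y ^+ t - 1)
      + (y ^+ 12 + y ^+ 11 - y ^+ 9 - y ^+ 8 + y ^+ 6 - y ^+ 4 - y ^+ 3 + y + 1) * cofactor ->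
    nontriv_overlap R 42 (Quad i j s t).
  by move=> lt_w in_q nontriv; rewrite Phi0 mul0r addr0; exact: nontriv_overlapI.
move: y {Phi0} overlap => y overlap.
repeat apply: List.Forall_cons; last exact: List.Forall_nil.
- apply: (overlap _ _ _ _ 3%N (- y ^+ 6 + y ^+ 5 + y - 1)) => //; ring.
- apply: (overlap _ _ _ _ 2%N (- y ^+ 6 + y ^+ 5 + y - 1)) => //; ring.
- apply: (overlap _ _ _ _ 2%N
    (- y ^+ 16 + y ^+ 15 - y ^+ 13 + y ^+ 12 - y ^+ 9 + 2 * y ^+ 8 - y ^+ 7 + y ^+ 4
     - y ^+ 3 + y - 1)) => //; ring.
Qed.

(** The polynomial is Phi_60(y) = Phi_30(y^2), hence the identity of level 30 with all exponents
    doubled. *)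
Lemma prim_root60_eq (F : numFieldType) (y : F) : 60.-primitive_root y ->
  y ^+ 16 + y ^+ 14 - y ^+ 10 - y ^+ 8 - y ^+ 6 + y ^+ 2 + 1 = 0.
Proof.
move=> pry; set p := (X in X = 0).
have y30 : y ^+ 30 + 1 = 0.
  have neq : y ^+ 30 - 1 != 0 by rewrite subr_eq0 -(expr0 y) (eq_prim_root_expr pry).
  apply: (mulfI neq); rewrite mulr0 -(subrr (y ^+ 60)) {2}(prim_expr_order pry); ring.
have neq n : ~~ (n * 2 == 0 %[mod 60])%N -> y ^+ n + 1 != 0.
  apply: contra; rewrite addr_eq0 => /eqP yn; rewrite -(eq_prim_root_expr pry) expr0 exprM yn.
  by rewrite sqrrN expr1n.
apply: (mulfI (neq 10%N isT)); apply: (mulfI (neq 6%N isT)).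
transitivity ((y ^+ 30 + 1) * (y ^+ 2 + 1)); first by rewrite /p; ring.
by rewrite y30 !mulr0 mul0r.
Qed.

Lemma sporadic60_nontriv (R : realType) : List.Forall (nontriv_overlap R 60) sporadic60.
Proof.
set y := phi R 60; have Phi0 := prim_root60_eq (phi_prim_root R (isT : (0 < 60)%N)).
have overlap i j s t w cofactor :
    (w < 60)%N -> in_k4 60 (Quad i j s t) -> ~~ trivial_quad 60 (Quad i j s t) ->
    y ^+ w * (y ^+ j - 1) * (y ^+ s - 1) = (y ^+ i - 1) * (y ^+ t - 1)
      + (y ^+ 16 + y ^+ 14 - y ^+ 10 - y ^+ 8 - y ^+ 6 + y ^+ 2 + 1) * cofactor ->
    nontriv_overlap R 60 (Quad i j s t).
  by move=> lt_w in_q nontriv; rewrite Phi0 mul0r addr0; exact: nontriv_overlapI.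
move: y {Phi0} overlap => y overlap.
repeat apply: List.Forall_cons; last exact: List.Forall_nil.
- apply: (overlap _ _ _ _ 5%N
    (- y ^+ 14 + y ^+ 12 + y ^+ 11 - y ^+ 10 - y ^+ 4 + y ^+ 3 + y ^+ 2 - 1)) => //; ring.
- apply: (overlap _ _ _ _ 3%N
    (- y ^+ 14 + y ^+ 12 + y ^+ 11 - y ^+ 10 - y ^+ 4 + y ^+ 3 + y ^+ 2 - 1)) => //; ring.
- apply: (overlap _ _ _ _ 3%N
    (- y ^+ 20 + y ^+ 18 + y ^+ 17 - y ^+ 16 - y ^+ 15 + y ^+ 13 + y ^+ 12
     - 2 * y ^+ 10 + y ^+ 8 + y ^+ 7 - y ^+ 5 - y ^+ 4 + y ^+ 3 + y ^+ 2 - 1)) => //; ring.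
Qed.

(** With s = sin(pi/6), the triple-angle formula gives 3 s - 4 s^3 = 1, that is (s - 1/2)^2 (s + 1)
    = 0, and s is positive. *)
Lemma sin_pi6 (R : realType) : sin (pi / 6%:R) = 2^-1 :> R.
Proof.
set a : R := pi / 6%:R; have s_gt0 : 0 < sin a.
  by apply: sin_gt0_pi; rewrite /a; have := pi_gt0 R; lra.
have : sin (a + (a + a)) = 1 by rewrite -sin_pihalf; congr sin; rewrite /a; field.
rewrite sinD -mulr2n sin_mulr2n cos_mulr2n; have := cos2Dsin2 a.
move: (sin a) (cos a) s_gt0 => s c s_gt0 cs1 triple.
have /eqP : (s - 2^-1) ^+ 2 * (s + 1) = 0.
  have c2 : c ^+ 2 = 1 - s ^+ 2 by lra.
  move: triple; rewrite !mulr2n.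
  have -> : s * (c ^+ 2 + c ^+ 2 - 1) + c * (c * s + c * s) = s * (4 * c ^+ 2 - 1) by ring.
  rewrite c2 => triple.
  transitivity (4^-1 * (1 - s * (4 * (1 - s ^+ 2) - 1))); first by field.
  by rewrite triple subrr mulr0.
rewrite mulf_eq0 expf_eq0 /= subr_eq0 => /orP[/eqP->//|/eqP]; lra.
Qed.

Lemma cos_pi3 (R : realType) : cos (pi / 3%:R) = 2^-1 :> R.
Proof.
have -> : pi / 3%:R = (pi / 6%:R) *+ 2 :> R by rewrite -mulr_natr; field.
by rewrite cos_mulr2n cos2sin2 sin_pi6 -mulr_natr; field.
Qed.

Lemma pm_congE k u v : in_k k u -> in_k k v -> pm_cong k u v = (u == v) || (u + v == k)%N.
Proof.
move=> /andP[u1 u2] /andP[v1 v2]; rewrite /pm_cong mod0n; congr orb.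
  by rewrite !modn_small //; lia.
apply/idP/eqP => [/dvdnP[[|[|c]] cE]|->]; try nia.
by rewrite modnn.
Qed.

Lemma trivial_quadE k q : in_k4 k q -> trivial_quad k q =
  [|| qi q == qj q, qi q + qj q == k, qj q == qt q, qj q + qt q == k,
      qt q == qs q, qt q + qs q == k, qs q == qi q | qs q + qi q == k]%N.
Proof.
by case/and4P=> hi hj hs ht; rewrite /trivial_quad !pm_congE // !orbA.
Qed.

Lemma nontriv_overlap_scale (R : realType) n m q : (0 < m)%N ->
  nontriv_overlap R n q -> nontriv_overlap R (n * m) (scale_quad m q).
Proof.
move=> m_gt0 nontriv_q; have n_gt0 : (0 < n)%N.
  by case: nontriv_q => -[/and4P[/andP[h1 h2] _ _ _] _] _; lia.
have nm_gt0 : (0 < n * m)%N by rewrite muln_gt0 n_gt0.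
case/nontriv_overlapE: nontriv_q => // in_q nontriv even_q sn_eq; apply/nontriv_overlapE => //.
have in_scale u : in_k n u -> in_k (n * m) (m * u).
  by rewrite /in_k /= => /andP[u1 u2]; rewrite muln_gt0 m_gt0 u1 /=; nia.
have sn_scale u : sin (angle R (n * m) (m * u)) = sin (angle R n u).
  congr sin; rewrite /angle !natrM; field.
  by rewrite !pnatr_eq0 -!lt0n n_gt0 m_gt0.
rewrite !sn_scale; split=> //.
- by case/and4P: in_q => *; rewrite /in_k4 !in_scale.
- have mod_scale u v : (m * u == m * v %[mod n * m])%N = (u == v %[mod n])%N.
    by rewrite [(n * m)%N]mulnC -!muln_modr eqn_pmul2l.
  have pm_scale u v : pm_cong (n * m) (m * u) (m * v) = pm_cong n u v.
    by rewrite /pm_cong mod_scale -(mod_scale (u + v)%N 0%N) muln0 mulnDr.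
  by rewrite /trivial_quad !pm_scale.
- by rewrite -!mulnDr oddM (negPf even_q) andbF.
Qed.

(** This is the double-angle formula sin(pi/6) sin(2x) = sin(x) cos(x) at x = u pi/k, since l pi/k =
    pi/6 and (3l - u) pi/k = pi/2 - x. *)
Lemma family_nontriv (R : realType) l u : (0 < u <= 6 * l %/ 4)%N -> u <> l ->
  nontriv_overlap R (6 * l) (Quad u l (2 * u) (3 * l - u)).
Proof.
move=> /andP[u1 u2] ul; have l_gt0 : (0 < l)%N by lia.
have in_q : in_k4 (6 * l) (Quad u l (2 * u) (3 * l - u)).
  by rewrite /in_k4 /in_k /=; lia.
apply/nontriv_overlapE; rewrite ?muln_gt0 //; split=> //.
- by rewrite trivial_quadE //=; lia.
- by rewrite /=; lia.
have lE : sin (angle R (6 * l) l) = 2^-1.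
  have -> : angle R (6 * l) l = pi / 6%:R.
    by rewrite /angle natrM; field; rewrite pnatr_eq0 -lt0n l_gt0.
  exact: sin_pi6.
have -> /= : angle R (6 * l) (3 * l - u) = pi / 2 - angle R (6 * l) u.
  rewrite /angle natrB; last by lia.
  by rewrite !natrM; field; rewrite pnatr_eq0 -lt0n l_gt0.
have -> : angle R (6 * l) (2 * u) = angle R (6 * l) u *+ 2.
  by rewrite mul2n -addnn angleD mulr2n.
rewrite lE sin_mulr2n -opprB sinN sinBpihalf opprK.
by field.
Qed.

Definition sporadic n : seq quad :=
  if n == 30%N then sporadic30 else if n == 42%N then sporadic42 else
  if n == 60%N then sporadic60 else [::].

Lemma listed_split k q w : listed k q w ->
  (exists l u, [/\ k = (6 * l)%N, (0 < u <= 6 * l %/ 4)%N, u <> l,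
     q = Quad u l (2 * u) (3 * l - u) & w = l%:Z - u%:Z]) \/
  exists n m q1, [/\ k = (n * m)%N, List.In q1 (sporadic n), q = scale_quad m q1 &
     2 * w = (qt q + qi q)%N%:Z - (qs q + qj q)%N%:Z].
Proof.
move=> [[l [u [-> [lt_u [ul [-> ->]]]]]]|h]; first by left; exists l, u.
right; case: h => [[m [-> h]]|[[m [-> h]]|[m [-> h]]]]; 
  [exists 30%N, m | exists 42%N, m | exists 60%N, m].
- case: h => [[-> ->]|[[-> ->]|[[-> ->]|[[-> ->]|[[-> ->]|[[-> ->]|[[-> ->]|[[-> ->]|[-> ->]]]]]]]]];
    [exists (Quad 1 3 3 11)
    |exists (Quad 3 5 5 9)
    |exists (Quad 7 9 9 13)
    |exists (Quad 1 2 4 9)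
    |exists (Quad 2 3 5 8)
    |exists (Quad 8 9 11 14)
    |exists (Quad 2 3 7 14)
    |exists (Quad 3 4 8 13)
    |exists (Quad 4 5 9 14)];
    split; rewrite ?mul1n //; try (by simpl; tauto);
    by [rewrite /scale_quad /= ?muln1 !(mulnC m) | rewrite /=; lia].
- case: h => [[-> ->]|[[-> ->]|[-> ->]]];
    [exists (Quad 2 3 9 16)
    |exists (Quad 3 4 10 15)
    |exists (Quad 8 9 15 20)];
    split; rewrite ?mul1n //; try (by simpl; tauto);
    by [rewrite /scale_quad /= ?muln1 !(mulnC m) | rewrite /=; lia].
- case: h => [[-> ->]|[[-> ->]|[-> ->]]];
    [exists (Quad 3 4 16 27)
    |exists (Quad 5 6 18 25)
    |exists (Quad 8 9 21 28)];
    split; rewrite ?mul1n //; try (by simpl; tauto);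
    by [rewrite /scale_quad /= ?muln1 !(mulnC m) | rewrite /=; lia].
Qed.

Lemma sporadic_nontriv (R : realType) n q : List.In q (sporadic n) -> nontriv_overlap R n q.
Proof.
move: q; apply/List.Forall_forall; rewrite /sporadic.
case: eqP => [->|_]; first exact: sporadic30_nontriv.
case: eqP => [->|_]; first exact: sporadic42_nontriv.
case: eqP => [->|_]; first exact: sporadic60_nontriv.
exact: List.Forall_nil.
Qed.

Lemma listed_nontriv (R : realType) k q w : (0 < k)%N ->
    listed k q w ->
  nontriv_overlap R k q /\ 2 * w = (qt q + qi q)%N%:Z - (qs q + qj q)%N%:Z.
Proof.
move=> k_gt0 /listed_split[[l [u [-> lt_u ul -> ->]]]|[n [m [q1 [kE q1_in -> ->]]]]].
  by split; [exact: family_nontriv | rewrite /=; lia].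
split=> //; rewrite kE; apply: nontriv_overlap_scale; first by lia.
exact: sporadic_nontriv.
Qed.

Lemma listed_dvd6 k q w : listed k q w -> (6 %| k)%N.
Proof.
move=> /listed_split[[l [u [-> _ _ _ _]]]|[n [m [q1 [-> q1_in _ _]]]]].
  exact: dvdn_mulr.
apply: dvdn_mulr; move: q1_in; rewrite /sporadic.
by case: eqP => [->|_] //; case: eqP => [->|_] //; case: eqP => [->|_].
Qed.

(** * The action of G_0 *)

Definition in_listed_orbit k q := exists q0 w, listed k q0 w /\ G0_orbit k q0 q.

Lemma in_listed_orbit_gen k g q :
  G0_gen k g -> in_listed_orbit k q -> in_listed_orbit k (g q).
Proof. by move=> gen_g [q0 [w [q0l q0q]]]; exists q0, w; split=> //; apply: G0_orbit_step. Qed.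

Lemma G0_gen_involutive k g q : G0_gen k g -> in_k4 k q -> g (g q) = q.
Proof.
case: q => i j s t gen_g /and4P[/= hi hj hs ht].
have compl u : in_k k u -> (k - (k - u))%N = u by rewrite /in_k; lia.
by case: gen_g => [|[|[|[|[|[|]]]]]] -> ;
   rewrite /kappa1 /kappa2 /kappa3 /kappa4 /swap_it /swap_js /swap_ij_st /= ?compl.
Qed.

(** Replacing [u] by [k - u] keeps the sine, and keeps the parity of the sum because [k] is even;
    the permutations preserve both products of sines up to exchanging them. *)
Lemma nontriv_overlap_gen (R : realType) k g q : (0 < k)%N -> ~~ odd k ->
  G0_gen k g -> nontriv_overlap R k q -> nontriv_overlap R k (g q).
Proof.
move=> k_gt0 even_k gen_g /nontriv_overlapE[]// in_q nontriv even_q sn_eq.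
have in_compl u : in_k k u -> in_k k (k - u) by rewrite /in_k; lia.
have sn_compl u : in_k k u -> sin (angle R k (k - u)) = sin (angle R k u).
  by move=> hu; apply: sin_angle_compl => //; move: hu; rewrite /in_k; lia.
have in_gq : in_k4 k (g q).
  by case: gen_g => [|[|[|[|[|[|]]]]]] ->; case/and4P: in_q => *; rewrite /in_k4 /= ?in_compl //;
     apply/and4P.
apply/nontriv_overlapE => //; split=> //.
- suff -> : trivial_quad k (g q) = trivial_quad k q by [].
  case/and4P: in_q; move: gen_g {in_gq even_q sn_eq nontriv}.
  case: q => i j s t /= gen_g hi hj hs ht.
  have pmC u v : pm_cong k u v = pm_cong k v u by rewrite /pm_cong eq_sym addnC.
  have pml u v : in_k k u -> in_k k v -> pm_cong k (k - u) v = pm_cong k u v.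
    by move=> hu hv; rewrite !pm_congE ?in_compl //; move: hu hv; rewrite /in_k; lia.
  have pmr u v : in_k k u -> in_k k v -> pm_cong k v (k - u) = pm_cong k v u.
    by move=> hu hv; rewrite pmC pml // pmC.
  case: gen_g => [|[|[|[|[|[|]]]]]] ->; rewrite /trivial_quad /= ?pml ?pmr //;
    rewrite ?[pm_cong k j i]pmC ?[pm_cong k t j]pmC ?[pm_cong k s t]pmC ?[pm_cong k i s]pmC;
    by case: (pm_cong k i j) (pm_cong k j t) (pm_cong k t s) (pm_cong k s i) => [] [] [] [].
- move: even_q; case/and4P: in_q; rewrite /in_k.
  move: gen_g {in_gq nontriv sn_eq}; case: q => i j s t /=.
  by case=> [|[|[|[|[|[|]]]]]] -> /=; lia.
- case/and4P: in_q; move: gen_g sn_eq {in_gq nontriv even_q}.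
  case: q => i j s t /= gen_g sn_eq hi hj hs ht.
  case: gen_g => [|[|[|[|[|[|]]]]]] -> /=; rewrite ?sn_compl //.
  + by rewrite sn_eq mulrC.
  + by rewrite mulrC.
Qed.

(** Orbits are generated forwards only; the generators being involutions, a quadruple may be
    replaced by its image before it is placed in an orbit. *)
Lemma in_listed_orbit_genK k g q :
  G0_gen k g -> in_k4 k q -> in_listed_orbit k (g q) -> in_listed_orbit k q.
Proof.
move=> gen_g in_q /(in_listed_orbit_gen gen_g).
by rewrite (G0_gen_involutive gen_g in_q).
Qed.

Lemma in_listed_orbit_nontriv (R : realType) k q : (0 < k)%N -> ~~ odd k ->
  in_listed_orbit k q -> nontriv_overlap R k q.
Proof.
move=> k_gt0 even_k [q0 [w [/(listed_nontriv R k_gt0)[q0_nontriv _]]]].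
by elim=> // g q' gen_g _; apply: nontriv_overlap_gen.
Qed.

(* [cos b] and [cos c] are the roots of y^2 - y cos d + cos^2 d - 3/4. *)
Lemma cos_sum_third (R : realType) (b c d : R) :
    cos b + cos c = cos d -> cos b ^+ 2 + cos c ^+ 2 + cos d ^+ 2 = 3 / 2 ->
  (cos b = cos (d + pi / 3%:R) /\ cos c = cos (d - pi / 3%:R)) \/
  (cos b = cos (d - pi / 3%:R) /\ cos c = cos (d + pi / 3%:R)).
Proof.
move=> sum1 sum2; have c3 := cos_pi3 R; have s3 := cos2Dsin2 (pi / 3%:R : R).
have sumE : cos (d + pi / 3%:R) + cos (d - pi / 3%:R) = cos d.
  by rewrite cosD cosB c3; field.
have prodE : cos (d + pi / 3%:R) * cos (d - pi / 3%:R) = cos d ^+ 2 - 3 / 4.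
  have sd := cos2Dsin2 d.
  have s2 : sin (pi / 3%:R) ^+ 2 = 3 / 4 :> R by rewrite sin2cos2 c3; field.
  rewrite cosD cosB c3.
  transitivity (cos d ^+ 2 / 4 - sin d ^+ 2 * sin (pi / 3%:R) ^+ 2); first by field.
  by rewrite s2 sin2cos2; field.
move: (cos (d + _)) (cos (d - _)) sumE prodE => y z sumE prodE.
have /eqP : (cos b - y) * (cos b - z) = 0.
  transitivity (cos b ^+ 2 - (y + z) * cos b + y * z); first by ring.
  rewrite sumE prodE -sum1; move: sum2; rewrite -sum1.
  move: (cos b) (cos c) => p q sum2.
  transitivity (2^-1 * ((p ^+ 2 + q ^+ 2 + (p + q) ^+ 2) - 3 / 2)); first by field.
  by rewrite sum2 subrr mulr0.
rewrite mulf_eq0 !subr_eq0 => /orP[]/eqP E; [left|right]; split=> //.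
  by apply: (addrI (cos b)); rewrite sum1 -sumE E.
by apply: (addrI (cos b)); rewrite sum1 -sumE E addrC.
Qed.

Lemma cos_angle_inj (R : realType) k m n : (0 < k)%N -> (m <= k)%N -> (n <= k)%N ->
  cos (angle R k m) = cos (angle R k n) -> m = n.
Proof.
move=> k_gt0 le_m le_n /cos_inj; have k0 : k%:R != 0 :> R by rewrite pnatr_eq0 -lt0n.
have itv u : (u <= k)%N -> angle R k u \in `[0, pi].
  move=> le_u; rewrite in_itv /= /angle divr_ge0 ?mulr_ge0 ?pi_ge0 //=.
  by rewrite ler_pdivrMr ?ltr0n // ler_pM2l ?pi_gt0 // ler_nat.
move=> /(_ (itv _ le_m) (itv _ le_n)) /(congr1 (fun x => x * k%:R / pi)).
rewrite /angle !mulfVK // ![pi * _]mulrC !mulfK ?gt_eqF ?pi_gt0 //.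
by move/eqP; rewrite eqr_nat => /eqP.
Qed.

(** * Descent from level 420 to level k *)

Lemma sporadic_listed n m q : List.In q (sporadic n) ->
  exists w, listed (n * m) (scale_quad m q) w.
Proof.
have mE a : (m * a = a * m)%N by rewrite mulnC.
rewrite /sporadic; case: eqP => [->|_].
  by do 9?[case=> [<-|]] => //=; rewrite /scale_quad /= ?muln1 !mE; eexists;
    right; left; exists m; (split; first by []); do 8?[by left; split | right].
case: eqP => [->|_].
  by do 3?[case=> [<-|]] => //=; rewrite /scale_quad /= ?muln1 !mE; eexists;
    do 2!right; left; exists m; (split; first by []); do 2?[by left; split | right].
case: eqP => [->|_] //.
by do 3?[case=> [<-|]] => //=; rewrite /scale_quad /= ?muln1 !mE; eexists;
  do 3!right; exists m; (split; first by []); do 2?[by left; split | right].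
Qed.

Lemma sporadic_coprime n q : List.In q (sporadic n) ->
  gcdn (gcdn (qi q) (qj q)) (gcdn (qs q) (qt q)) = 1%N.
Proof.
rewrite /sporadic; case: eqP => _; first by do 9?[case=> [<- //|]].
case: eqP => _; first by do 3?[case=> [<- //|]].
by case: eqP => _ //; do 3?[case=> [<- //|]].
Qed.

Lemma has_In (T : Type) (a : pred T) s : has a s -> exists x, List.In x s /\ a x.
Proof.
elim: s => //= x s IHs /orP[ax|/IHs[y [ys ay]]]; first by exists x; split; [left|].
by exists y; split; [right|].
Qed.

Lemma has_listed420 a : has a listed420 ->
  (exists u, [/\ (0 < u <= 105)%N, u != 70%N & a (Quad u 70 (2 * u) (210 - u))]) \/
  exists n c q, [/\ (n * c = 420)%N, List.In q (sporadic n) & a (scale_quad c q)].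
Proof.
rewrite /listed420 !has_cat !has_map => /or4P[/hasP[u]|||].
- rewrite mem_filter mem_iota => /andP[u70 lt_u] au; left; exists u; split=> //; lia.
- by move=> /has_In[q [qs aq]]; right; exists 30%N, 14%N, q.
- by move=> /has_In[q [qs aq]]; right; exists 42%N, 10%N, q.
- by move=> /has_In[q [qs aq]]; right; exists 60%N, 7%N, q.
Qed.

(** In the infinite family the entry 70 gives [k = 6 j]. In a sporadic case [n] divides [k] times
    each entry of the primitive quadruple, whose entries have gcd 1, so [n] divides [k]. *)
Lemma listed420_descent k q (a : pred quad) : (0 < k)%N -> has a listed420 ->
    (forall q0, a q0 -> [/\ 420 * qi q = k * qi q0, 420 * qj q = k * qj q0,
       420 * qs q = k * qs q0 & 420 * qt q = k * qt q0]%N) ->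
  exists w, listed k q w.
Proof.
move=> k_gt0 /has_listed420[[u [lt_u u70 au]]|[n [c [q1 [ncE q1_in aq1]]]]] rel.
  have [] := rel _ au; case: q {rel} => i j s t /= Ei Ej Es Et.
  exists (j%:Z - i%:Z); left; exists j, i; split; first by lia.
  split; first by nia.
  split; first by nia.
  by split=> //; congr Quad; nia.
have [] := rel _ aq1; case: q {rel} => i j s t; rewrite /scale_quad /= -ncE => Ei Ej Es Et.
have c_gt0 : (0 < c)%N by lia.
have red x y : (n * c * x = k * (c * y) -> n * x = k * y)%N.
  by move=> E; apply/eqP; rewrite -(eqn_pmul2l c_gt0); apply/eqP; nia.
move: Ei Ej Es Et => /red Ei /red Ej /red Es /red Et.
have n_gt0 : (0 < n)%N by lia.
have n_k : (n %| k)%N.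
  rewrite -[k]muln1 -(sporadic_coprime q1_in) !muln_gcdr -Ei -Ej -Es -Et.
  by rewrite -!muln_gcdr dvdn_mulr.
have kE : k = (n * (k %/ n))%N by rewrite mulnC divnK.
move: kE {n_k}; set m := (k %/ n)%N => kE.
have red2 x y : (n * x = k * y -> x = m * y)%N.
  by rewrite kE -mulnA => /eqP; rewrite eqn_pmul2l // => /eqP.
by rewrite (red2 _ _ Ei) (red2 _ _ Ej) (red2 _ _ Es) (red2 _ _ Et) kE; exact: sporadic_listed.
Qed.

Lemma listed_in_orbit k q w : listed k q w -> in_listed_orbit k q.
Proof. by move=> qw; exists q, w; split=> //; exact: G0_orbit_base. Qed.

Lemma quad_match_orbit k i j s t i' j' s' t' : (0 < k)%N ->
    [/\ 420 * i = k * i', 420 * j = k * j', 420 * s = k * s' & 420 * t = k * t']%N ->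
    in_k4 k (Quad i j s t) ->
  has (quad_match (s', j')%N (t', i')%N) listed420 -> in_listed_orbit k (Quad i j s t).
Proof.
move=> k_gt0 [Ei Ej Es Et] in_q.
have gen_it : G0_gen k swap_it by do 4!right; left.
have gen_js : G0_gen k swap_js by do 5!right; left.
have in_it : in_k4 k (Quad t j s i) by case/and4P: in_q => *; apply/and4P.
pose a (x1 x2 y1 y2 : nat) q0 := (x1 == qj q0) && (x2 == qs q0) && ((y1 == qi q0) && (y2 == qt q0)).
have -> : has (quad_match (s', j') (t', i')) listed420 =
    [|| has (a s' j' t' i') listed420, has (a j' s' t' i') listed420,
        has (a s' j' i' t') listed420 | has (a j' s' i' t') listed420].
  rewrite -!has_predU; apply: eq_has => q0 /=; rewrite /quad_match /same_pair /a /=.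
  rewrite [(j' == _) && _]andbC [(i' == _) && _]andbC.
  by case: ((s' == _) && _) ((s' == _) && _) ((t' == _) && _) ((t' == _) && _)
    => [] [] [] [].
case/or4P=> /(listed420_descent k_gt0) descent.
- have [|w /listed_in_orbit] := descent (Quad t s j i).
    by move=> q0 /andP[/andP[/eqP<- /eqP<-] /andP[/eqP<- /eqP<-]].
  move/(in_listed_orbit_gen gen_it)/(in_listed_orbit_gen gen_js); by [].
- have [|w /listed_in_orbit] := descent (Quad t j s i).
    by move=> q0 /andP[/andP[/eqP<- /eqP<-] /andP[/eqP<- /eqP<-]].
  by move/(in_listed_orbit_gen gen_it).
- have [|w /listed_in_orbit] := descent (Quad i s j t).
    by move=> q0 /andP[/andP[/eqP<- /eqP<-] /andP[/eqP<- /eqP<-]].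
  by move/(in_listed_orbit_gen gen_js).
have [|w /listed_in_orbit] := descent (Quad i j s t).
  by move=> q0 /andP[/andP[/eqP<- /eqP<-] /andP[/eqP<- /eqP<-]].
by [].
Qed.

Lemma angle_scale (R : realType) m k n : (0 < m)%N ->
  angle R (m * k) (m * n) = angle R k n.
Proof.
move=> m_gt0; rewrite /angle !natrM mulrCA -mulf_div divff ?mul1r //.
by rewrite pnatr_eq0 -lt0n.
Qed.

(** * Every nontrivial overlap lies in a listed orbit *)

(** By [cos_sum_third], [j - s] and [i + t] are [i - t] shifted by [k / 3] in opposite directions,
    up to sign. The equation for [i + t] gives [k = 6 i] or [k = 6 t]; the other one, with
    [2 (j + s) = k], then gives [t = 2 s] or [i = 2 s]. Level [3 * k] makes the shift an integer. *)
Lemma quarter_sum_orbit (R : realType) k i j s t :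
    let cs n := cos (angle R k n) in
    (0 < s <= j)%N -> (0 < t <= i)%N -> (2 * i <= k)%N -> (2 * j <= k)%N ->
    s <> i -> s <> t -> (2 * (j + s) = k)%N ->
    cs (j - s)%N + cs (i + t)%N = cs (i - t)%N ->
    cs (j - s)%N ^+ 2 + cs (i + t)%N ^+ 2 + cs (i - t)%N ^+ 2 = 3 / 2 ->
  in_listed_orbit k (Quad i j s t).
Proof.
move=> cs lt_s lt_t le_i le_j si st jsE sum1 sum2.
have k_gt0 : (0 < k)%N by lia.
have csE n : cs n = cos (angle R (3 * k) (3 * n)) by rewrite angle_scale.
have third : angle R (3 * k) k = pi / 3%:R.
  by rewrite /angle natrM; field; rewrite pnatr_eq0 -lt0n k_gt0.
have plusE d : cos (angle R k d + pi / 3%:R) = cos (angle R (3 * k) (3 * d + k)).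
  by rewrite angleD third angle_scale.
(* The sum of the two truncated differences is the absolute value of [3 * d - k], one of them being
   0; cosine is even. *)
have minusE d : cos (angle R k d - pi / 3%:R) =
    cos (angle R (3 * k) ((3 * d - k) + (k - 3 * d))).
  have [le_d|/ltnW le_d] := leqP k (3 * d).
    have -> : angle R k d = angle R (3 * k) ((3 * d - k) + k) by rewrite subnK // angle_scale.
    by rewrite angleD third addrK (eqP le_d) addn0.
  rewrite (eqP le_d) add0n -cosN opprB; congr cos.
  have split_k : angle R (3 * k) k = angle R (3 * k) (k - 3 * d) + angle R k d.
    by rewrite -(@angle_scale R 3 k d) // -angleD subnK.
  by rewrite -third split_k addrK.
have gen_it : G0_gen k swap_it by do 4!right; left.
have gen_js : G0_gen k swap_js by do 5!right; left.
have gen_ij : G0_gen k swap_ij_st by do 6!right.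
have inj m n : (m <= 3 * k)%N -> (n <= 3 * k)%N ->
    cos (angle R (3 * k) m) = cos (angle R (3 * k) n) -> m = n.
  by apply: cos_angle_inj; lia.
have [[/eqP Eb /eqP Ec]|[/eqP Eb /eqP Ec]] := cos_sum_third sum1 sum2.
- move: Eb Ec; rewrite -/(cs _) csE plusE => /eqP/inj Eb.
  rewrite -/(cs _) csE minusE => /eqP/inj Ec.
  have {}Eb := Eb ltac:(lia) ltac:(lia); have {}Ec := Ec ltac:(lia) ltac:(lia).
  have listed_q : listed k (Quad s i t j) (i%:Z - s%:Z).
    left; exists i, s; split; first by lia.
    split; first by lia.
    split=> //; split=> //; congr Quad; lia.
  move/listed_in_orbit: listed_q.
  by move=> /(in_listed_orbit_gen gen_ij)/(in_listed_orbit_gen gen_js).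
- move: Eb Ec; rewrite -/(cs _) csE minusE => /eqP/inj Eb.
  rewrite -/(cs _) csE plusE => /eqP/inj Ec.
  have {}Eb := Eb ltac:(lia) ltac:(lia); have {}Ec := Ec ltac:(lia) ltac:(lia).
  have listed_q : listed k (Quad s t i j) (t%:Z - s%:Z).
    left; exists t, s; split; first by lia.
    split; first by lia.
    split=> //; split=> //; congr Quad; lia.
  move/listed_in_orbit: listed_q => /(in_listed_orbit_gen gen_ij).
  by move/(in_listed_orbit_gen gen_js)/(in_listed_orbit_gen gen_it).
Qed.
Lemma four_cosines_real (R : realType) k a b c d : (0 < k)%N ->
    let cs n := cos (angle R k n) in
    cs a + cs b + cs c + cs d = 0 ->
  [\/ [&& 2 * k %| 420 * a, 2 * k %| 420 * b, 2 * k %| 420 * c & 2 * k %| 420 * d]%N,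
      [\/ cs a + cs b = 0, cs a + cs c = 0 | cs a + cs d = 0] |
      [\/ cs a = 0 /\ cs b ^+ 2 + cs c ^+ 2 + cs d ^+ 2 = 3 / 2,
          cs b = 0 /\ cs a ^+ 2 + cs c ^+ 2 + cs d ^+ 2 = 3 / 2,
          cs c = 0 /\ cs a ^+ 2 + cs b ^+ 2 + cs d ^+ 2 = 3 / 2 |
          cs d = 0 /\ cs a ^+ 2 + cs b ^+ 2 + cs c ^+ 2 = 3 / 2]].
Proof.
move=> k_gt0 cs sum0.
have prz : (2 * k).-primitive_root (phi R (2 * k)) by rewrite phi_prim_root ?muln_gt0.
have xE n : phi R (2 * k) ^+ n + phi R (2 * k) ^- n = real_complex R (2 * cs n).
  exact: phi_double_sum_inv.
have two0 : (2 : R) != 0 by rewrite pnatr_eq0.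
have pairE m n : real_complex R (2 * cs m) + real_complex R (2 * cs n) = 0 -> cs m + cs n = 0.
  by rewrite -rmorphD -mulrDr => /eqP; rewrite fmorph_eq0 mulf_eq0 (negPf two0) => /eqP.
have sqE m n p : real_complex R (2 * cs m) ^+ 2 + real_complex R (2 * cs n) ^+ 2 +
    real_complex R (2 * cs p) ^+ 2 = 6%:R -> cs m ^+ 2 + cs n ^+ 2 + cs p ^+ 2 = 3 / 2.
  rewrite -(rmorph_nat (real_complex R)) -!rmorphXn -!rmorphD => /complexI sq.
  apply: (mulfI (_ : (4 : R) != 0)); first by rewrite pnatr_eq0.
  by transitivity (6%:R : R); [rewrite -sq; ring | field].
have zeroE n : real_complex R (2 * cs n) = 0 -> cs n = 0.
  by move/eqP; rewrite fmorph_eq0 mulf_eq0 (negPf two0) => /eqP.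
have /(four_cosines prz) : phi R (2 * k) ^+ a + phi R (2 * k) ^- a +
    (phi R (2 * k) ^+ b + phi R (2 * k) ^- b) + (phi R (2 * k) ^+ c + phi R (2 * k) ^- c) +
    (phi R (2 * k) ^+ d + phi R (2 * k) ^- d) = 0.
  by rewrite !xE -!rmorphD -!mulrDr sum0 mulr0 rmorph0.
rewrite !xE; case=> [h|[]/pairE h|[][/zeroE h1 /sqE h2]].
- by constructor 1.
- by constructor 2; constructor 1.
- by constructor 2; constructor 2.
- by constructor 2; constructor 3.
- by constructor 3; constructor 1.
- by constructor 3; constructor 2.
- by constructor 3; constructor 3.
- by constructor 3; constructor 4.
Qed.

Lemma eq_angle (R : realType) k m a b : (0 < k)%N -> (0 < m)%N ->
  (m * a = k * b)%N -> angle R k a = angle R m b.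
Proof.
by move=> k_gt0 m_gt0 E; rewrite -(@angle_scale R m k a) // E mulnC angle_scale.
Qed.

(** Sum and difference of the two quotients rescale [u] and [v] themselves. Their gap [2 * e] is
    even, which is the shape of the pairs in the collision table. *)
Lemma rescale_pair k u v : (0 < k)%N -> (v <= u)%N ->
    (2 * k %| 420 * (u + v))%N -> (2 * k %| 420 * (u - v))%N ->
  exists u' v' e, [/\ 420 * u = k * u', 420 * v = k * v', u' = v' + 2 * e,
    210 * (u - v) = k * e & 210 * (u + v) = k * (v' + e)]%N.
Proof.
move=> k_gt0 le_vu /dvdnP[X EX] /dvdnP[Y EY].
have le_YX : (Y <= X)%N by rewrite -(@leq_pmul2r (2 * k)) ?muln_gt0 // -EX -EY; lia.
exists (X + Y)%N, (X - Y)%N, Y; split.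
- by rewrite mulnDr; lia.
- by rewrite mulnBr; lia.
- by lia.
- by lia.
- by rewrite subnK //; lia.
Qed.

Lemma torsion420_orbit (R : realType) k i j s t :
    let cs n := cos (angle R k n) in
    (0 < s <= j)%N -> (0 < t <= i)%N -> (2 * i <= k)%N -> (2 * j <= k)%N ->
    in_k4 k (Quad i j s t) -> s <> i -> s <> t ->
    [&& 2 * k %| 420 * (j + s + k), 2 * k %| 420 * (j - s),
        2 * k %| 420 * (i - t + k) & 2 * k %| 420 * (i + t)]%N ->
    cs (j - s)%N - cs (j + s)%N = cs (i - t)%N - cs (i + t)%N ->
  in_listed_orbit k (Quad i j s t).
Proof.
have pos u u' : (0 < u)%N -> (420 * u = k * u')%N -> (0 < u')%N.
  by move=> u_gt0 E; rewrite lt0n; apply/eqP => u'0; rewrite u'0 muln0 in E; lia.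
have small u u' : (0 < k)%N -> (2 * u <= k)%N -> (420 * u = k * u')%N -> (u' <= 210)%N.
  by move=> k_gt0 le_u E; rewrite -(leq_pmul2l k_gt0) -E; lia.
have same u v u' : (420 * u = k * u')%N -> (420 * v = k * u')%N -> u = v by lia.
move=> cs /andP[s_gt0 le_sj] /andP[t_gt0 le_ti] le_i le_j in_q si st.
have k_gt0 : (0 < k)%N by lia.
(* The shift by [k] turns a cosine into its opposite, and -1 is itself a 420-th root of unity, so
   the shift drops out of the divisibilities. *)
have dvd_k : (2 * k %| 420 * k)%N by rewrite dvdn_pmul2r.
rewrite ![(420 * (_ + k))%N]mulnDr !(dvdn_addl _ dvd_k) => /and4P[dvd1 dvd2 dvd3 dvd4] eq_cs.
have [j' [s' [e [Ej Es j'E Ee Es']]]] := rescale_pair k_gt0 le_sj dvd1 dvd2.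
have [i' [t' [f [Ei Et i'E Ef Et']]]] := rescale_pair k_gt0 le_ti dvd4 dvd3.
have gen_ij : G0_gen k swap_ij_st by do 6!right.
have pr420 : 420.-primitive_root (phi R 420) by rewrite phi_prim_root.
have xE m n : (210 * m = k * n)%N ->
    phi R 420 ^+ n + phi R 420 ^- n = real_complex R (2 * cs m).
  by move=> E; rewrite (phi_double_sum_inv R 210) /cs (@eq_angle R k 210 m n).
have := @cosine_collisions420 _ (phi R 420) s' e t' f pr420 (pos _ _ s_gt0 Es) _ (pos _ _ t_gt0 Et).
rewrite -j'E -i'E (small _ _ k_gt0 le_j Ej) (small _ _ k_gt0 le_i Ei) => /(_ isT isT).
rewrite (xE _ _ Ee) (xE _ _ Es') (xE _ _ Ef) (xE _ _ Et') -!rmorphB -!mulrBr eq_cs.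
(* Equal pairs would give [s = t] or [s = i]; otherwise the collision is listed, directly or after
   exchanging the two products. *)
move=> /(_ erefl)/or3P[/orP[]/andP[/eqP /= E1 /eqP /= E2]||].
- by case: st; apply: same Es _; rewrite E1.
- by case: si; apply: same Es _; rewrite E1.
- exact: quad_match_orbit.
move=> match_ij; apply: (in_listed_orbit_genK gen_ij) => //.
apply: quad_match_orbit match_ij => //.
by case/and4P: in_q => *; apply/and4P.
Qed.

(** With entries at most [k / 2], the four sums and differences lie in [0, k], where cosine is
    injective: opposite cosines then force [s = 0], [s = t] or [i = j]. A vanishing cosine must be
    that of [j + s] or of [i + t], as the differences are less than [k / 2]. *)
Lemma folded_orbit (R : realType) k i j s t : (0 < k)%N -> ~~ odd k ->
    (s <= j)%N -> (t <= i)%N -> (2 * i <= k)%N -> (2 * j <= k)%N ->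
  nontriv_overlap R k (Quad i j s t) -> in_listed_orbit k (Quad i j s t).
Proof.
move=> k_gt0 even_k le_sj le_ti le_i le_j /nontriv_overlapE[]// in_q.
have /and4P[/= hi hj hs ht] := in_q.
have s_gt0 : (0 < s)%N by case/andP: hs.
have t_gt0 : (0 < t)%N by case/andP: ht.
rewrite trivial_quadE //= => nontriv _ sn_eq.
pose cs n := cos (angle R k n).
have gen_ij : G0_gen k swap_ij_st by do 6!right.
have angleB m n : (n <= m)%N -> angle R k (m - n) = angle R k m - angle R k n.
  by move=> le_nm; rewrite -{2}(subnK le_nm) angleD addrK.
have prodE m n : (n <= m)%N -> 2 * (sin (angle R k m) * sin (angle R k n)) =
    cs (m - n)%N - cs (m + n)%N.
  by move=> le_nm; rewrite sinM_cosB /cs angleB // angleD.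
have eq_cs : cs (j - s)%N - cs (j + s)%N = cs (i - t)%N - cs (i + t)%N.
  by rewrite -!prodE // sn_eq.
have csDk n : cs (n + k)%N = - cs n.
  by rewrite /cs angleD {2}/angle mulfK ?cosDpi // pnatr_eq0 -lt0n.
have inj m n : (m <= k)%N -> (n <= k)%N -> cs m = cs n -> m = n by exact: cos_angle_inj.
have csBk n : (n <= k)%N -> cs (k - n)%N = - cs n.
  move=> le_n; have pik : angle R k k = pi by rewrite /angle mulfK // pnatr_eq0 -lt0n.
  by rewrite /cs angleB // pik addrC cosDpi cosN.
have compl m n : (m <= k)%N -> (n <= k)%N -> cs m + cs n = 0 -> (m + n = k)%N.
  move=> le_m le_n /eqP; rewrite addr_eq0 -csBk // => /eqP/(inj _ _ le_m (leq_subr _ _)).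
  by lia.
have half n : (n <= k)%N -> cs n = 0 -> (2 * n = k)%N.
  by move=> le_n cs0; rewrite mul2n -addnn; apply: compl => //; rewrite cs0 addr0.
(* Adding [k] to an index changes the sign of the cosine, so the relation becomes a plain sum. *)
have sum0 : cs (j + s + k)%N + cs (j - s)%N + cs (i - t + k)%N + cs (i + t)%N = 0.
  by rewrite !csDk -(subrr (cs (i - t)%N - cs (i + t)%N)) -{1}eq_cs; ring.
have lt_sj : (0 < s <= j)%N by rewrite s_gt0.
have lt_ti : (0 < t <= i)%N by rewrite t_gt0.
have si : s <> i by lia.
have st : s <> t by lia.
have le_a : (j + s <= k)%N by lia.
have le_b : (j - s <= k)%N by lia.
have le_c : (i + t <= k)%N by lia.
have le_d : (i - t <= k)%N by lia.
have [|[]|[][]] := four_cosines_real k_gt0 sum0; rewrite -!/(cs _) ?csDk.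
- move=> dvds; exact: torsion420_orbit lt_sj lt_ti le_i le_j in_q si st dvds eq_cs.
- by move/eqP; rewrite addrC subr_eq0 => /eqP/(inj _ _ le_b le_a); lia.
- move=> cs_ad; have sum_ad : cs (j + s)%N + cs (i - t)%N = 0 by lra.
  have sum_bc : cs (j - s)%N + cs (i + t)%N = 0 by lra.
  have := compl _ _ le_a le_d sum_ad; have := compl _ _ le_b le_c sum_bc; lia.
- move=> cs_ac; have eq_ac : cs (j + s)%N = cs (i + t)%N by lra.
  have eq_bd : cs (j - s)%N = cs (i - t)%N by lra.
  have := inj _ _ le_a le_c eq_ac; have := inj _ _ le_b le_d eq_bd; lia.
- move=> cs_a; rewrite sqrrN => sq.
  have cs_a0 : cs (j + s)%N = 0 by lra.
  have sum_bc : cs (j - s)%N + cs (i + t)%N = cs (i - t)%N by lra.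
  have sq_bc : cs (j - s)%N ^+ 2 + cs (i + t)%N ^+ 2 + cs (i - t)%N ^+ 2 = 3 / 2 by lra.
  exact: quarter_sum_orbit lt_sj lt_ti le_i le_j si st (half _ le_a cs_a0) sum_bc sq_bc.
- by move/(half _ le_b); lia.
- move=> cs_d; have cs_d0 : cs (i - t)%N = 0 by lra.
  by have := half _ le_d cs_d0; lia.
move=> cs_c; rewrite !sqrrN => sq.
have tj : t <> j by lia.
have sum_da : cs (i - t)%N + cs (j + s)%N = cs (j - s)%N by lra.
have sq_da : cs (i - t)%N ^+ 2 + cs (j + s)%N ^+ 2 + cs (j - s)%N ^+ 2 = 3 / 2 by lra.
apply: (in_listed_orbit_genK gen_ij) => //.
exact: quarter_sum_orbit lt_ti lt_sj le_j le_i tj (nesym st) (half _ le_c cs_c) sum_da sq_da.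
Qed.

(** Each generator is spent on one normalisation: the kappa_m fold the entries below [k / 2], and
    two swaps order the pairs (t, i) and (s, j). *)
Lemma nontriv_in_orbit (R : realType) k q : (0 < k)%N -> ~~ odd k ->
  nontriv_overlap R k q -> in_listed_orbit k q.
Proof.
move=> k_gt0 even_k q_nontriv.
have via g q' : G0_gen k g -> nontriv_overlap R k q' ->
    (nontriv_overlap R k (g q') -> in_listed_orbit k (g q')) -> in_listed_orbit k q'.
  move=> gen_g ov_q' orbit_gq'; apply: (in_listed_orbit_genK gen_g); first by case: ov_q' => -[].
  exact/orbit_gq'/nontriv_overlap_gen.
wlog le_i : q q_nontriv / (2 * qi q <= k)%N.
  move=> main; have [|gt_i] := leqP (2 * qi q) k; first exact: main.
  by apply: (via (kappa1 k)) => // [|ov]; [left | apply: main => //=; lia].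
wlog le_j : q q_nontriv le_i / (2 * qj q <= k)%N.
  move=> main; have [|gt_j] := leqP (2 * qj q) k; first exact: main.
  by apply: (via (kappa2 k)) => // [|ov]; [right; left | apply: main => //=; lia].
wlog le_s : q q_nontriv le_i le_j / (2 * qs q <= k)%N.
  move=> main; have [|gt_s] := leqP (2 * qs q) k; first exact: main.
  by apply: (via (kappa3 k)) => // [|ov]; [do 2!right; left | apply: main => //=; lia].
wlog le_t : q q_nontriv le_i le_j le_s / (2 * qt q <= k)%N.
  move=> main; have [|gt_t] := leqP (2 * qt q) k; first exact: main.
  by apply: (via (kappa4 k)) => // [|ov]; [do 3!right; left | apply: main => //=; lia].
wlog le_ti : q q_nontriv le_i le_j le_s le_t / (qt q <= qi q)%N.
  move=> main; have [|gt_t] := leqP (qt q) (qi q); first exact: main.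
  by apply: (via swap_it) => // [|ov]; [do 4!right; left | apply: main => //=; lia].
wlog le_sj : q q_nontriv le_i le_j le_s le_t le_ti / (qs q <= qj q)%N.
  move=> main; have [|gt_s] := leqP (qs q) (qj q); first exact: main.
  by apply: (via swap_js) => // [|ov]; [do 5!right; left | apply: main => //=; lia].
case: q q_nontriv le_i le_j le_s le_t le_ti le_sj => i j s t /= *.
exact: (@folded_orbit R).
Qed.

Theorem theorem26 (R : realType) (k : nat) :
  (4 <= k)%N -> ~~ odd k ->
  ((exists q, nontriv_overlap R k q) -> (6 %| k)%N) /\
  (forall q, nontriv_overlap R k q <->
     exists q0 w, listed k q0 w /\ G0_orbit k q0 q) /\
  (forall q w, listed k q w ->
     [/\ nontriv_overlap R k q,
         phi R k ^ w * ((phi R k ^+ qj q - 1) / (phi R k ^+ qi q - 1))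
           = (phi R k ^+ qt q - 1) / (phi R k ^+ qs q - 1) &
         (2 * w = ((qt q + qi q)%N%:Z - (qs q + qj q)%N%:Z))%R]).
Proof.
move=> k_ge4 even_k; have k_gt0 : (0 < k)%N by apply: leq_trans k_ge4.
split; last split.
- move=> [q /(nontriv_in_orbit k_gt0 even_k)[q0 [w [q0_listed _]]]].
  exact: listed_dvd6 q0_listed.
- move=> q; split; first exact: nontriv_in_orbit.
  exact: in_listed_orbit_nontriv.
move=> q w /(listed_nontriv R k_gt0)[q_nontriv w_eq]; split=> //.
have [in_q _ _ sn_eq] := (nontriv_overlapE R q k_gt0).1 q_nontriv.
have /and4P[/andP[i_gt0 lt_i] _ /andP[s_gt0 lt_s] _] := in_q.
by apply: overlap_ratio => //; lia.
Qed.
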